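(* For $t_0,t_1>0$ put $$f_{t_0,t_1}(s)=\frac{s^2}{t_0t_1\cdot\max\left\{\frac{s}{t_1}+\frac{1-s}{t_0},\ \frac{s}{t_0}\right\}},\qquad \mathcal E_{(t_0,t_1)}(\Psi)=\Big\{x\in[0,1):\ a_n(x)^{t_0}a_{n+1}(x)^{t_1}\ge\Psi(n)\ \text{for infinitely many } n\in\mathbb N\Big\}.$$ Then $f_{2,1}(s)<f_{1,2}(s)$ for every $1/2<s<1$, and for every function $\Psi:\mathbb N\to[1,\infty)$ such that $B=\exp\big(\liminf_{n\to\infty}\frac{\log\Psi(n)}{n}\big)$ satisfies $1<B<\infty$ one has $$\dim_{\mathrm H}\mathcal E_{(2,1)}(\Psi)>\dim_{\mathrm H}\mathcal E_{(1,2)}(\Psi).$$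
   Context: $\mathbb N=\{1,2,3,\dots\}$; $\dim_{\mathrm H}$ denotes Hausdorff dimension. For irrational $x\in[0,1)$, $a_1(x),a_2(x),\ldots\in\mathbb N$ denote the partial quotients of the regular continued fraction expansion $x=[a_1(x),a_2(x),\dots]=1/(a_1(x)+1/(a_2(x)+\cdots))$. Rational $x$ (a countable set) are irrelevant to the statement. *)

(* Defs.v *)
From mathcomp Require Import all_boot all_order all_algebra.
From mathcomp Require Import all_classical all_reals all_analysis.

Set Implicit Arguments.
Unset Strict Implicit.
Unset Printing Implicit Defensive.

Import Order.TTheory GRing.Theory Num.Theory.
Import numFieldNormedType.Exports.

Local Open Scope classical_set_scope.
Local Open Scope ring_scope.

(* The value 0 is added so that the diameter of the empty set is 0, not -oo. *)
Definition diameter (R : realType) (A : set R) : \bar R :=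
  ereal_sup (0%E |` [set (`|p.1 - p.2|)%:E | p in A `*` A]).

(* diam(A)^s with the conventions 0^0 = 1 for nonempty A, and 0 for the empty
   set (also at s = 0). *)
Definition diam_pow (R : realType) (s : R) (A : set R) : \bar R :=
  if `[< A = set0 >] then 0%E else (diameter A `^ s)%E.

Definition delta_cover (R : realType) (d : R) (A : set R) (U : nat -> set R) :
    Prop :=
  A `<=` \bigcup_i U i /\ forall i, (diameter (U i) <= d%:E)%E.

Definition hausdorff_premeasure (R : realType) (s d : R) (A : set R) : \bar R :=
  ereal_inf [set (\sum_(0 <= i <oo) diam_pow s (U i))%E
            | U in [set U : nat -> set R | delta_cover d A U]].

(* The limit as d tends to 0+ is a supremum, by monotonicity in d. *)
Definition hausdorff_measure (R : realType) (s : R) (A : set R) : \bar R :=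
  ereal_sup [set hausdorff_premeasure s d A | d in [set d : R | 0 < d]].

Definition hausdorff_dim (R : realType) (A : set R) : \bar R :=
  ereal_inf [set s%:E | s in [set s : R | 0 <= s /\ hausdorff_measure s A = 0%E]].

(* x |-> 1/x mod 1, with 0 |-> 0 since 0^-1 = 0. *)
Definition gauss_map (R : realType) (x : R) : R :=
  x^-1 - (Num.floor x^-1)%:~R.

(* The partial quotient a_n(x), for n >= 1 and x in [0, 1[. For rational x the
   finite expansion is continued by zeros, so a_n(x) = 0 for all large n. *)
Definition partial_quotient (R : realType) (n : nat) (x : R) : nat :=
  Num.truncn (iter n.-1 (@gauss_map R) x)^-1.

(* [Psi] is only used at n >= 1. When t0, t1 > 0 and Psi >= 1, rational points
   do not belong to this set, since their products are eventually 0. *)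
Definition E_set (R : realType) (t0 t1 : R) (Psi : nat -> R) : set R :=
  [set x | 0 <= x < 1 /\
    infinite_set [set n | (1 <= n)%N /\
      Psi n <= (partial_quotient n x)%:R `^ t0
               * (partial_quotient n.+1 x)%:R `^ t1]].

Definition f_exponent (R : realType) (t0 t1 s : R) : R :=
  s ^+ 2 / (t0 * t1 * Num.max (s / t1 + (1 - s) / t0) (s / t0)).

(* Main.v *)
(** A finite word [w] of digits has a continuant [q w] ([cfq] below), which is
    multiplicative up to a factor 2, and the cylinder of [w] has length about
    [(q w)^-2].  Write [P s] for the exponential growth rate in [n] of the sum of
    [(q w)^(-2 s)] over all words of length [n], [b = ln B],
    [l s = s^2 / (1 + s)], which is [f_(2,1)] on (1/2, 1), and
    [u s = s^2 / (2 (1 - s + s^2))], which satisfies [l < u <= f_(1,2)] there.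

    If [P s < b u s], covering the points with [a_n a_(n+1)^2 >= B^n] by cylinders
    (one set for all large [a_n], one set for each small [a_n]) gives
    [dim E_(1,2) <= s].  If [P s > b l s], the points whose digits are bounded
    except for [a_n ~ B^(n s / (1 + s))] and [a_(n+1) ~ B^(n (1 - s) / (1 + s))]
    along a sparse sequence of [n] form a Cantor subset of [E_(2,1)] of dimension
    at least [s].  The first condition holds at [s = 1] and is open to the left,
    the second one holds near [s = 1/2] and is open to the right, and as [l < u]
    each [s] in (1/2, 1) satisfies one of them; so some [s] satisfies both, and
    then the second condition persists for a slightly larger exponent. *)
Require Import Defs.
From mathcomp Require Import all_boot all_order all_algebra.
From mathcomp Require Import all_classical all_reals all_analysis.
From mathcomp Require Import ring lra zify.

Import Order.TTheory GRing.Theory Num.Theory.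
Import numFieldNormedType.Exports.

Local Open Scope classical_set_scope.
Local Open Scope ring_scope.

(** * Continued fractions and cylinders *)

(** The growth rate $P$ is never formed. Each condition on it is an inequality at a single word
    length, which concatenation propagates: [subcritical] holds uniformly in the bound [M] on the
    digits, [supercritical] for one [M]. The second is stable under small changes of $s$ because a
    finite sum is continuous; for the first, stability has to be uniform in [M].

    The exact exponent $f_{(1,2)}$ has two branches meeting at $s = 2/3$, according to whether
    $\sum_a a^{-3s/2}$ converges in the part of the cover with small $a_n$. The function $u$ is what
    the same cover gives when this sum is bounded by one formula on all of (1/2, 1); the loss is
    small enough to keep $u > l$.

    For the lower bound the Cantor set carries no constructed measure: it is parametrised by [0, 1),
    and $|y - y'| \le C |f(y) - f(y')|^s$ is proved for the parametrisation $f$. The sizes $X$ and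
    $Y$ of the two large digits are forced by $X^2 Y = B^n$ and $Y^s = X^{1-s}$; the latter keeps
    mass and diameter in step between the two digits. *)

Fixpoint cf (R : realType) (w : seq nat) (x : R) : R :=
  if w is a :: w' then (a%:R + cf R w' x)^-1 else x.
Arguments cf {R} w x.

(** In the usual notation this is $q_n + x q_{n-1}$, the denominator of the Möbius map [cf w];
    written as a product of complete quotients it splits over concatenation. *)
Fixpoint den (R : realType) (w : seq nat) (x : R) : R :=
  if w is a :: w' then (a%:R + cf w' x) * den R w' x else 1.
Arguments den {R} w x.

Definition cfq {R : realType} (w : seq nat) : R := den w 0.

Definition pos_word (w : seq nat) : bool := all (leq 1) w.

Section ContinuedFractions.
Context {R : realType}.
Implicit Types (x y : R) (u v w : seq nat) (a : nat).

Lemma cf_bounds w x : pos_word w -> 0 <= x <= 1 -> 0 <= cf w x <= 1.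
Proof.
elim: w => [//|a w IH] /= /andP[a1 /IH{}IH] /IH /andP[c0 c1].
have a1R : 1 <= a%:R :> R by rewrite ler1n.
have p : 1 <= a%:R + cf w x by lra.
by rewrite invr_ge0 (le_trans ler01 p) /= invf_le1// (lt_le_trans ltr01 p).
Qed.

Lemma cf_gt0 w x : pos_word w -> 0 <= x <= 1 -> w != [::] -> 0 < cf w x.
Proof.
case: w => [//|a w] /= /andP[a1 pw] /(cf_bounds _ _ pw) /andP[c0 _] _.
have a1R : 1 <= a%:R :> R by rewrite ler1n.
by rewrite invr_gt0; lra.
Qed.

Lemma cf_itv01 w x : pos_word w -> 0 < x < 1 -> 0 < cf w x < 1.
Proof.
elim: w => [//|a w IH] /= /andP[a1 /IH{}IH] /IH /andP[c0 c1].
have a1R : 1 <= a%:R :> R by rewrite ler1n.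
have p : 1 < a%:R + cf w x by lra.
by rewrite invr_gt0 (lt_trans ltr01 p) /= invf_lt1// (lt_trans ltr01 p).
Qed.

Lemma den_ge1 w x : pos_word w -> 0 <= x <= 1 -> 1 <= den w x.
Proof.
elim: w => [//|a w IH] /= /andP[a1 pw] x01.
have /andP[c0 c1] := cf_bounds _ _ pw x01.
have a1R : 1 <= a%:R :> R by rewrite ler1n.
by rewrite mulr_ege1// ?IH//; lra.
Qed.

Lemma den_gt0 w x : pos_word w -> 0 <= x <= 1 -> 0 < den w x.
Proof. by move=> pw x01; exact: lt_le_trans ltr01 (den_ge1 _ _ pw x01). Qed.

Lemma cf_cat u v x : cf (u ++ v) x = cf u (cf v x).
Proof. by elim: u => //= a u ->. Qed.

Lemma den_cat u v x : den (u ++ v) x = den u (cf v x) * den v x.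
Proof. by elim: u => [|a u IH] /=; rewrite ?mul1r// cf_cat IH mulrA. Qed.

(** [cf w] is a Möbius map with denominator [den w] and determinant $(-1)^{|w|}$. *)
Lemma cf_sub w x y : pos_word w -> 0 <= x <= 1 -> 0 <= y <= 1 ->
  cf w x - cf w y = (-1) ^+ size w * (x - y) / (den w x * den w y).
Proof.
move=> + x01 y01; elim: w => [_|a w IH] /=; first by rewrite expr0; field.
move=> /andP[a1 pw].
have /andP[cx0 _] := cf_bounds _ _ pw x01.
have /andP[cy0 _] := cf_bounds _ _ pw y01.
have a1R : 1 <= a%:R :> R by rewrite ler1n.
have dx := den_gt0 _ _ pw x01; have dy := den_gt0 _ _ pw y01.
have -> : (a%:R + cf w x)^-1 - (a%:R + cf w y)^-1 =
   - (cf w x - cf w y) / ((a%:R + cf w x) * (a%:R + cf w y)).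
  by field; apply/andP; split; apply: lt0r_neq0; lra.
rewrite IH// exprS; field.
by do !(apply/andP; split); apply: lt0r_neq0; lra.
Qed.

Lemma cf_dist w x y : pos_word w -> 0 <= x <= 1 -> 0 <= y <= 1 ->
  `|cf w x - cf w y| = `|x - y| / (den w x * den w y).
Proof.
move=> pw x01 y01; rewrite cf_sub// normrM normrM normrX normrN1 expr1n mul1r.
by rewrite normfV (gtr0_norm (mulr_gt0 (den_gt0 _ _ pw x01) (den_gt0 _ _ pw y01))).
Qed.

Lemma den_cons2 a b w x : pos_word (b :: w) -> 0 <= x <= 1 ->
  den (a :: b :: w) x = a%:R * den (b :: w) x + den w x.
Proof.
move=> /= /andP[b1 pw] x01; have /andP[c0 _] := cf_bounds _ _ pw x01.
have b1R : 1 <= b%:R :> R by rewrite ler1n.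
have h : b%:R + cf w x != 0 by apply: lt0r_neq0; lra.
by field.
Qed.

(** The continuant recurrence [den_cons2] refers to two shorter words. Its coefficients are
    positive, so it carries a linear comparison from words of length at most one to all words. *)
Let ind2 (P : seq nat -> Prop) : P [::] -> (forall a, P [:: a]) ->
  (forall a b w, P w -> P (b :: w) -> P (a :: b :: w)) -> forall w, P w.
Proof.
move=> h0 h1 h2 w; suff : P w /\ forall a, P (a :: w) by case.
elim: w => [|b w [IH1 IH2]]; split => // a; exact: h2.
Qed.

Lemma den_le2 w x y : pos_word w -> 0 <= x <= 1 -> 0 <= y <= 1 ->
  den w y <= 2 * den w x.
Proof.
move=> + x01 y01; elim/ind2: w => [_|a|a b w IH IHb].
- by rewrite /=; lra.
- by rewrite /= => /andP[a1 _]; have a1R : 1 <= a%:R :> R; [rewrite ler1n|lra].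
- move=> /andP[a1 pbw]; rewrite !den_cons2//.
  have a1R : 1 <= a%:R :> R by rewrite ler1n.
  have pw : pos_word w by case/andP: pbw.
  have h := IHb pbw; have h' := IH pw.
  have : a%:R * den (b :: w) y <= a%:R * (2 * den (b :: w) x).
    by rewrite ler_wpM2l//; lra.
  lra.
Qed.

Lemma cfq_le_den w x : pos_word w -> 0 <= x <= 1 -> cfq w <= den w x.
Proof.
have z01 : 0 <= (0 : R) <= 1 by rewrite lexx ler01.
move=> + x01; rewrite /cfq; elim/ind2: w => [_|a|a b w IH IHb].
- by rewrite /=; lra.
- by rewrite /= => /andP[a1 _]; lra.
- move=> /andP[a1 pbw]; rewrite !den_cons2//.
  have a1R : 1 <= a%:R :> R by rewrite ler1n.
  have pw : pos_word w by case/andP: pbw.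
  have h := IHb pbw; have h' := IH pw.
  have : a%:R * den (b :: w) 0 <= a%:R * den (b :: w) x.
    by rewrite ler_wpM2l//; lra.
  lra.
Qed.

Lemma cfq_ge1 w : pos_word w -> 1 <= cfq w :> R.
Proof. by move=> pw; apply: den_ge1; rewrite // lexx ler01. Qed.

Lemma cfq_gt0 w : pos_word w -> 0 < cfq w :> R.
Proof. by move=> pw; apply: den_gt0; rewrite // lexx ler01. Qed.

Lemma den_le_cfq w x : pos_word w -> 0 <= x <= 1 -> den w x <= 2 * cfq w.
Proof. by move=> pw x01; apply: den_le2; rewrite // lexx ler01. Qed.

Lemma cfq_cat_ge u v : pos_word u -> pos_word v ->
  cfq u * cfq v <= cfq (u ++ v) :> R.
Proof.
move=> pu pv; have z01 : 0 <= (0 : R) <= 1 by rewrite lexx ler01.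
rewrite [leRHS]den_cat ler_wpM2r// ?(ltW (cfq_gt0 _ pv))//.
exact/cfq_le_den/cf_bounds.
Qed.

Lemma cfq_cat_le u v : pos_word u -> pos_word v ->
  cfq (u ++ v) <= 2 * (cfq u * cfq v) :> R.
Proof.
move=> pu pv; have z01 : 0 <= (0 : R) <= 1 by rewrite lexx ler01.
rewrite [leLHS]den_cat mulrA ler_wpM2r// ?(ltW (cfq_gt0 _ pv))//.
exact/den_le_cfq/cf_bounds.
Qed.

Lemma cfq1 a : cfq [:: a] = a%:R :> R.
Proof. by rewrite /cfq /= addr0 mulr1. Qed.

Lemma cf_dist_le w x y : pos_word w -> 0 <= x <= 1 -> 0 <= y <= 1 ->
  `|cf w x - cf w y| <= `|x - y| / cfq w ^+ 2.
Proof.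
move=> pw x01 y01; rewrite cf_dist// ler_wpM2l//.
have q0 := cfq_gt0 _ pw; rewrite lef_pV2 ?posrE ?exprn_gt0//; last first.
  by rewrite mulr_gt0 ?den_gt0.
by rewrite expr2 ler_pM ?cfq_le_den// ltW.
Qed.

Lemma cf_dist_ge w x y : pos_word w -> 0 <= x <= 1 -> 0 <= y <= 1 ->
  `|x - y| / (4 * cfq w ^+ 2) <= `|cf w x - cf w y|.
Proof.
move=> pw x01 y01; rewrite cf_dist// ler_wpM2l//.
have q0 := cfq_gt0 _ pw; rewrite lef_pV2 ?posrE; last 2 first.
- by rewrite mulr_gt0 ?exprn_gt0.
- by rewrite mulr_gt0 ?den_gt0.
have -> : 4 * cfq w ^+ 2 = (2 * cfq w) * (2 * cfq w) :> R by ring.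
by rewrite ler_pM ?den_le_cfq// ltW// den_gt0.
Qed.

Lemma pos_word_cat u v : pos_word (u ++ v) = pos_word u && pos_word v.
Proof. exact: all_cat. Qed.

End ContinuedFractions.

(** * Reading partial quotients off a cylinder *)

Section GaussMap.
Context {R : realType}.
Implicit Types (x y z : R) (w : seq nat) (a n k : nat).

Lemma truncn_addr01 a z : 0 <= z < 1 -> Num.truncn (a%:R + z) = a.
Proof.
by move=> /andP[z0 z1]; apply: truncn_def; rewrite -natr1; apply/andP; split; lra.
Qed.

Lemma gauss_map_cf a w z : pos_word (a :: w) -> 0 < z < 1 ->
  gauss_map (cf (a :: w) z) = cf w z.
Proof.
move=> /= /andP[_ pw] z01; have /andP[c0 c1] := cf_itv01 _ _ pw z01.
rewrite /gauss_map invrK.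
rewrite (@floor_def _ _ a%:Z) -?pmulrn; first by ring.
by rewrite natrD; apply/andP; split; lra.
Qed.

Lemma iter_gauss_map_cf k w z : pos_word w -> 0 < z < 1 -> (k <= size w)%N ->
  iter k (@gauss_map R) (cf w z) = cf (drop k w) z.
Proof.
move=> + z01; elim: w k => [|a w IH] [|k] //= pw kw.
have pw' : pos_word w by case/andP: pw.
by rewrite -iterS iterSr gauss_map_cf// IH.
Qed.

Lemma partial_quotient_cf n w z : pos_word w -> 0 < z < 1 -> (n < size w)%N ->
  partial_quotient n.+1 (cf w z) = nth 0%N w n.
Proof.
move=> pw z01 nw; rewrite /partial_quotient /=.
have -> := iter_gauss_map_cf n w z pw z01 (ltnW nw).
rewrite (drop_nth 0%N nw) [cf _ _]/= invrK.
have pd : pos_word (drop n.+1 w).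
  by move: pw; rewrite -{1}(cat_take_drop n.+1 w) pos_word_cat => /andP[].
by have /andP[c0 c1] := cf_itv01 _ _ pd z01; rewrite truncn_addr01// ltW.
Qed.

Lemma gauss_map0 : gauss_map (0 : R) = 0.
Proof. by rewrite /gauss_map invr0 floor0 subrr. Qed.

Lemma gauss_map_itv x : 0 <= gauss_map x < 1.
Proof.
have /andP[h1 h2] := floor_itv x^-1; move: h2; rewrite intrD /gauss_map => h2.
by apply/andP; split; lra.
Qed.

Lemma cf_truncn_gauss_map x : 0 < x < 1 ->
  (0 < Num.truncn x^-1)%N /\ x = ((Num.truncn x^-1)%:R + gauss_map x)^-1.
Proof.
move=> /andP[x0 x1].
have x1' : 1 < x^-1 by rewrite invf_gt1.
split; first by rewrite truncn_gt0 ltW.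
rewrite /gauss_map truncn_floor invr_ge0 (ltW x0).
have : 0 <= Num.floor x^-1 by rewrite floor_ge0 invr_ge0 ltW.
case: (Num.floor x^-1) => // m _ /=.
by rewrite -pmulrn addrC subrK invrK.
Qed.

(** 0 is a fixed point of the Gauss map, so positivity of the last iterate makes all earlier ones
    positive, and the first [n] digits are genuine. *)
Lemma cf_iter_gauss_map n x : 0 <= x < 1 -> 0 < iter n (@gauss_map R) x ->
  exists w, [/\ size w = n, pos_word w & x = cf w (iter n (@gauss_map R) x)].
Proof.
elim: n x => [|n IH] x x01; first by exists [::].
rewrite iterSr => h; have [w [sw pw xw]] := IH _ (gauss_map_itv x) h.
have x0 : 0 < x.
  rewrite lt_neqAle eq_sym; case/andP: x01 => -> _; rewrite andbT.
  by apply: contraTneq h => ->; rewrite gauss_map0 iter_fix ?gauss_map0// ltxx.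
have [|t0 xE] := cf_truncn_gauss_map x; first by rewrite x0; case/andP: x01.
by exists (Num.truncn x^-1 :: w); split; rewrite /= ?sw ?t0// -xw -xE.
Qed.

End GaussMap.

(** * Sums over words *)

Fixpoint words (M n : nat) : seq (seq nat) :=
  if n is n'.+1 then [seq a :: w | a <- iota 1 M, w <- words M n'] else [:: [::]].

Definition wsum (R : realType) (M n : nat) (s : R) : R :=
  \sum_(w <- words M n) cfq w `^ (- (2 * s)).

Arguments wsum {R} M n s.

Section Words.
Context {R : realType}.
Implicit Types (M n m : nat) (w : seq nat) (s : R).

Lemma mem_words M n w :
  (w \in words M n) = (size w == n) && all (fun a => 0 < a <= M)%N w.
Proof.
elim: n w => [|n IH] [|a w] //=.
- by apply/allpairsP => -[[? ?] []].
- apply/allpairsP/idP => [[[b v] /= [hb hv [-> ->]]]|].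
    by move: hv hb; rewrite IH mem_iota eqSS add1n ltnS => /andP[-> ->] ->.
  rewrite eqSS => /and3P[sw ha hw]; exists (a, w); split => //=.
    by rewrite mem_iota add1n ltnS.
  by rewrite IH sw.
Qed.

Lemma words_uniq M n : uniq (words M n).
Proof.
elim: n => [//|n IH] /=; apply: allpairs_uniq; rewrite ?iota_uniq//.
by move=> [a w] [b v] _ _ /= [-> ->].
Qed.

Lemma words_pos M n w : w \in words M n -> pos_word w.
Proof. by rewrite mem_words => /andP[_]; apply: sub_all => a /andP[]. Qed.

Lemma words_size M n w : w \in words M n -> size w = n.
Proof. by rewrite mem_words => /andP[/eqP]. Qed.

Lemma big_words_cat M m n (G : seq nat -> R) :
  \sum_(w <- words M (m + n)) G w =
  \sum_(u <- words M m) \sum_(v <- words M n) G (u ++ v).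
Proof.
elim: m G => [|m IH] G; first by rewrite /= big_seq1.
rewrite addSn /= !big_allpairs_dep; apply: eq_bigr => a _.
by rewrite IH.
Qed.

Lemma big_words1 M (G : seq nat -> R) :
  \sum_(w <- words M 1) G w = \sum_(a <- iota 1 M) G [:: a].
Proof.
by rewrite /=; elim: (iota 1 M) => [|a r IH]; rewrite ?big_nil//= !big_cons IH.
Qed.

Lemma wsum_ge0 M n s : 0 <= wsum M n s.
Proof. by apply: sumr_ge0 => w _; exact: powR_ge0. Qed.

Lemma cfq_powRN_le w s s' : pos_word w -> s <= s' ->
  cfq w `^ (- (2 * s')) <= (cfq w : R) `^ (- (2 * s)).
Proof. by move=> pw ss'; rewrite ler_powR ?cfq_ge1//; lra. Qed.

Lemma wsum_anti M n s s' : s <= s' -> wsum M n s' <= wsum M n s.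
Proof.
move=> ss'; rewrite /wsum !big_seq; apply: ler_sum => w /words_pos pw.
exact: cfq_powRN_le.
Qed.

(** Continuants are supermultiplicative and the exponent $-2s$ is nonpositive. This inequality does
    the work of the existence of a growth rate. *)
Lemma wsum_cat_le M m n s : 0 <= s -> wsum M (m + n) s <= wsum M m s * wsum M n s.
Proof.
move=> s0; rewrite /wsum big_words_cat mulr_suml !big_seq.
apply: ler_sum => u /words_pos pu; rewrite mulr_sumr !big_seq.
apply: ler_sum => v /words_pos pv.
have qu := cfq_gt0 (R := R) _ pu; have qv := cfq_gt0 (R := R) _ pv.
have quv : 0 < cfq (u ++ v) :> R by rewrite cfq_gt0// pos_word_cat pu.
rewrite -(powRM _ (ltW qu) (ltW qv)) !powRN lef_pV2 ?posrE ?powR_gt0 ?mulr_gt0//.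
apply: ge0_ler_powR; rewrite ?nnegrE ?(ltW quv) ?(ltW (mulr_gt0 qu qv))//.
  by rewrite mulr_ge0.
exact: cfq_cat_ge.
Qed.

Lemma wsum1 M s : wsum M 1 s = \sum_(a <- iota 1 M) a%:R `^ (- (2 * s)).
Proof. by rewrite /wsum big_words1; apply: eq_bigr => a _; rewrite cfq1. Qed.

Let len w : R := (-1) ^+ size w * (cf w 1 - cf w 0).

(* The intervals [cf w `[0, 1]] over words w of a fixed length do not overlap. *)
Lemma sum_cf_length_le1 M n : \sum_(w <- words M n) len w <= 1.
Proof.
elim: n => [|n IH]; first by rewrite /= big_seq1 /len /= expr0; lra.
apply: le_trans IH; rewrite -addn1 big_words_cat !big_seq.
apply: ler_sum => u /words_pos pu; rewrite big_words1.
(* The cylinders of [u ++ [:: a]] with [a <= M] lie end to end and fill the image under [cf u] of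
   $[1/(M+1), 1]$. *)
have -> : \sum_(a <- iota 1 M) len (u ++ [:: a]) =
    (-1) ^+ size u * (cf u 1 - cf u (M.+1%:R^-1)).
  elim: M => [|k IHk]; first by rewrite big_nil invr1 subrr mulr0.
  rewrite -(addn1 k) iotaD big_cat IHk /= big_seq1 add1n /len !cf_cat size_cat /=.
  by rewrite !addn1 exprSr addr0 natr1; ring.
rewrite /len.
have h0 : 0 <= (0 : R) <= 1 by rewrite lexx ler01.
have hM : 0 <= (M.+1%:R^-1 : R) <= 1.
  by rewrite invr_ge0 ler0n /= invf_le1// ler1n.
have -> : cf u 1 - cf u M.+1%:R^-1 =
  (cf u 1 - cf u 0) - (cf u M.+1%:R^-1 - cf u 0) :> R by ring.
rewrite mulrBr lerBlDr lerDl (cf_sub u M.+1%:R^-1)// mulrA mulrA -expr2.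
rewrite -exprM mulnC exprM sqrrN expr1n expr1n mul1r subr0.
by rewrite divr_ge0 ?mulr_ge0 ?ltW ?den_gt0//; case/andP: hM.
Qed.

(** A cylinder has length [(den w 1 * cfq w)^-1], and [den w 1 <= 2 * cfq w], so $q^{-2}$ is at most
    twice that length. *)
Lemma wsum_at1_le2 M n : wsum M n (1 : R) <= 2.
Proof.
have := sum_cf_length_le1 M n.
suff : wsum M n (1 : R) <= 2 * \sum_(w <- words M n) len w by lra.
rewrite mulr_sumr /wsum !big_seq; apply: ler_sum => w /words_pos pw.
have h0 : 0 <= (0 : R) <= 1 by rewrite lexx ler01.
have h1 : 0 <= (1 : R) <= 1 by rewrite lexx ler01.
have q0 := cfq_gt0 (R := R) _ pw; have d1 := den_gt0 _ _ pw h1.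
rewrite mulr1 (powR_invn _ (ltW q0)) /len cf_sub// subr0 mulr1 mulrA -expr2.
rewrite -exprM mulnC exprM sqrrN expr1n expr1n -/(cfq w) div1r.
have -> : 2 * (den w 1 * cfq w)^-1 = (den w 1 / 2 * cfq w)^-1 :> R.
  by field; rewrite !lt0r_neq0.
rewrite lef_pV2 ?posrE ?exprn_gt0 ?mulr_gt0 ?divr_gt0//.
by rewrite expr2 ler_wpM2r ?(ltW q0)// ler_pdivrMr// mulrC den_le_cfq.
Qed.

End Words.

(** * Dependence of the sums on the exponent *)

Section PowerSums.
Context {R : realType}.
Implicit Types (x p s : R) (M n : nat).

Lemma powR_expR x p : 0 < x -> x `^ p = expR (p * ln x).
Proof. by move=> x0; rewrite /powR gt_eqF. Qed.

Lemma big_iota1S M (F : nat -> R) :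
  \sum_(a <- iota 1 M.+1) F a = \sum_(a <- iota 1 M) F a + F M.+1.
Proof. by rewrite -{1}(addn1 M) iotaD big_cat /= big_seq1 add1n. Qed.

(* [k^-p <= ((k-1)^(1-p) - k^(1-p)) / (p-1)] for [k >= 2], and the right-hand
   sides telescope. *)
Lemma pseries_bounded p : 1 < p ->
  forall M, \sum_(a <- iota 1 M) (a%:R : R) `^ (- p) <= 1 + (p - 1)^-1.
Proof.
move=> p1 M; have p10 : 0 < p - 1 by lra.
case: M => [|M]; first by rewrite big_nil addr_ge0// invr_ge0 ltW.
suff : \sum_(a <- iota 1 M.+1) (a%:R : R) `^ (- p) <=
       1 + (p - 1)^-1 - (M.+1%:R) `^ (1 - p) / (p - 1).
  by move/le_trans; apply; rewrite gerBl divr_ge0 ?powR_ge0 ?ltW.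
elim: M => [|M IH]; first by rewrite /= big_seq1 !powR1 mul1r addrK.
rewrite big_iota1S; apply: le_trans (lerD IH (lexx _)) _.
suff : (M.+2%:R : R) `^ (- p) <= (M.+1%:R `^ (1 - p) - M.+2%:R `^ (1 - p)) / (p - 1).
  by rewrite mulrBl; lra.
rewrite ler_pdivlMr//.
have m0 : (0 : R) < M.+1%:R by rewrite ltr0n.
have m1 : (0 : R) < M.+2%:R by rewrite ltr0n.
have mm : (M.+2%:R : R) = M.+1%:R + 1 by rewrite natr1.
have -> : (M.+2%:R : R) `^ (- p) = M.+2%:R `^ (1 - p) / M.+2%:R.
  rewrite -{3}(powRr1 (ltW m1)) -powRB; first by congr (_ `^ _); ring.
  by rewrite (gt_eqF m1) implybT.
have -> : (M.+1%:R : R) `^ (1 - p) = M.+2%:R `^ (1 - p) * (M.+1%:R / M.+2%:R) `^ (1 - p).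
  rewrite -powRM ?divr_ge0 ?ltW//; congr (_ `^ _).
  by field; rewrite !lt0r_neq0.
have : 1 + (p - 1) / M.+2%:R <= (M.+1%:R / M.+2%:R : R) `^ (1 - p).
  rewrite powR_expR ?divr_gt0//; apply: le_trans (expR_ge1Dx _).
  rewrite lerD2l -(opprB p 1) mulNr -mulrN ler_wpM2l ?(ltW p10)//.
  have -> : M.+1%:R / M.+2%:R = 1 + - M.+2%:R^-1 :> R.
    rewrite mm; field; rewrite lt0r_neq0//; lra.
  have h : (M.+2%:R^-1 : R) < 1 by rewrite invf_lt1// ltr1n.
  by rewrite lerNr le_ln1Dx// ltrN2.
have : 0 < (M.+2%:R : R) `^ (1 - p) by rewrite powR_gt0.
set u := _.+2%:R `^ (1 - p); set v := (_ / _) `^ (1 - p) => u0 h.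
have : u * (1 + (p - 1) / M.+2%:R) <= u * v by rewrite ler_wpM2l// ltW.
by rewrite mulrDr mulr1 mulrA (mulrAC u _ (p - 1)) -lerBrDl.
Qed.

Lemma ln_le_harmonic M : ln M.+1%:R <= \sum_(a <- iota 1 M) (a%:R : R) `^ (- 1).
Proof.
elim: M => [|M IH]; first by rewrite big_nil ln1.
rewrite big_iota1S; apply: le_trans (lerD IH (lexx _)).
have m0 : (0 : R) < M.+1%:R by rewrite ltr0n.
rewrite (powR_inv1 (ltW m0)) -lerBlDl -ln_div ?posrE ?ltr0n//.
have -> : M.+2%:R / M.+1%:R = 1 + M.+1%:R^-1 :> R.
  by rewrite -natr1; field; rewrite lt0r_neq0.
have : (0 : R) < M.+1%:R^-1 by rewrite invr_gt0.
by move=> h; rewrite le_ln1Dx// (lt_trans _ h)// ltrN10.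
Qed.

Lemma wsum_bounded s : 1 / 2 < s ->
  exists2 Z, 1 <= Z & forall M n, wsum M n s <= Z ^+ n.
Proof.
move=> s12; exists (1 + (2 * s - 1)^-1).
  by rewrite lerDl invr_ge0; lra.
move=> M; elim=> [|n IH]; first by rewrite /wsum /= big_seq1 expr0 /cfq /= powR1.
rewrite -addn1; apply: le_trans (wsum_cat_le _ _ _ _ _) _; first lra.
rewrite addn1 exprSr ler_pM ?wsum_ge0// wsum1.
by have := pseries_bounded (2 * s); apply; lra.
Qed.

Lemma continuous_wsum M n : continuous (wsum M n : R -> R).
Proof.
have -> : wsum M n =
    (fun s : R => \sum_(w <- words M n | w \in words M n) expR (- (2 * s) * ln (cfq w))).
  apply/funext => t; rewrite /wsum big_seq; apply: eq_bigr => w /words_pos pw.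
  by rewrite powR_expR// cfq_gt0.
move=> s; apply: cvg_big => [|w _]; first by move=> x; exact: add_continuous.
apply: continuous_comp; last exact: continuous_expR.
apply: cvgM; last exact: cvg_cst.
apply: cvgN; apply: cvgM; [exact: cvg_cst|exact: cvg_id].
Qed.

(* Split the words according to whether [2 ln q <= K]. *)
Lemma wsum_interpolation M n (K s' s s0 : R) : 0 <= K -> s' <= s <= s0 ->
  wsum M n s <= expR (K * (s0 - s)) * wsum M n s0 + expR (- K * (s - s')) * wsum M n s'.
Proof.
move=> K0 /andP[s's ss0]; rewrite /wsum !mulr_sumr -big_split /= !big_seq.
apply: ler_sum => w /words_pos pw.
have q0 := cfq_gt0 (R := R) _ pw; rewrite !powR_expR// -!expRD.
have [h|h] := leP (2 * ln (cfq w)) K.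
- apply: ler_wpDr; first exact: expR_ge0.
  rewrite ler_expR.
  have : (s0 - s) * (2 * ln (cfq w)) <= (s0 - s) * K by rewrite ler_wpM2l//; lra.
  lra.
- apply: ler_wpDl; first exact: expR_ge0.
  rewrite ler_expR.
  have : (s - s') * K <= (s - s') * (2 * ln (cfq w)).
    by rewrite ler_wpM2l//; [lra|exact: ltW].
  lra.
Qed.

End PowerSums.

(** * An exponent between the two dimensions *)

Definition lower_exponent (R : realType) (s : R) : R := s ^+ 2 / (1 + s).
Definition upper_exponent (R : realType) (s : R) : R :=
  s ^+ 2 / (2 * (1 - s + s ^+ 2)).
Arguments lower_exponent {R} s.
Arguments upper_exponent {R} s.

(** One length [n] suffices by submultiplicativity. Uniformity in [M] admits all digits, and
    [b1 < b] is the room that later yields a convergent geometric series. *)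
Definition subcritical (R : realType) (b s : R) : Prop :=
  exists n b1, [/\ (0 < n)%N, 0 < b1 < b &
    forall M, wsum M n s <= expR (n%:R * (b1 * upper_exponent s))].

(* The constant 64 and the exponent [N.+1] leave room for a separating digit
   after each block of [N] digits. *)
Definition supercritical (R : realType) (b s : R) : Prop :=
  exists N M, (0 < N)%N /\
    64 * expR (N.+1%:R * (b * lower_exponent s)) < wsum M N s.
Arguments subcritical {R} b s.
Arguments supercritical {R} b s.

Section Gap.
Context {R : realType}.
Implicit Types (s b : R).

Lemma f_exponent21_lt12 s : 1 / 2 < s < 1 -> f_exponent 2 1 s < f_exponent 1 2 s.
Proof.
move=> /andP[s12 s1]; rewrite /f_exponent !divr1 mulr1 mul1r.
have s20 : 0 < s ^+ 2 by rewrite exprn_gt0//; lra.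
rewrite ltr_pM2l// ltf_pV2 ?posrE; last 2 first.
- by rewrite mulr_gt0// lt_max; apply/orP; left; lra.
- by rewrite mulr_gt0// lt_max; apply/orP; left; lra.
rewrite ltr_pM2l// gt_max !lt_max; apply/andP; split; apply/orP; left; lra.
Qed.

Lemma upper_exponent_gt0 s : 0 < s -> 0 < upper_exponent s.
Proof.
move=> s0; rewrite divr_gt0 ?exprn_gt0// mulr_gt0//.
by have := sqr_ge0 (s - 1 / 2); rewrite !expr2; lra.
Qed.

Lemma lower_exponent_gt0 s : 0 < s -> 0 < lower_exponent s.
Proof. by move=> s0; rewrite divr_gt0 ?exprn_gt0// addr_gt0. Qed.

Lemma lower_lt_upper_exponent s : 1 / 2 < s < 1 ->
  lower_exponent s < upper_exponent s.
Proof.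
move=> /andP[s12 s1]; have s0 : 0 < s by lra.
rewrite ltr_pM2l ?exprn_gt0//.
have p : 0 < (2 * s - 1) * (1 - s) by rewrite mulr_gt0; lra.
rewrite ltf_pV2 ?posrE; [nra|lra|].
by have := sqr_ge0 (s - 1 / 2); rewrite !expr2; lra.
Qed.

Lemma continuous_lower_exponent s : 0 < s -> {for s, continuous (@lower_exponent R)}.
Proof.
move=> s0; apply: cvgM; first by apply: cvgM; exact: cvg_id.
apply: cvgV; first by rewrite lt0r_neq0// addr_gt0.
by apply: cvgD; [exact: cvg_cst|exact: cvg_id].
Qed.

Lemma continuous_upper_exponent s : {for s, continuous (@upper_exponent R)}.
Proof.
apply: cvgM; first by apply: cvgM; exact: cvg_id.
apply: cvgV.
  by have h := sqr_ge0 (s - 1 / 2); rewrite lt0r_neq0//; move: h; rewrite !expr2; lra.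
apply: cvgM; first exact: cvg_cst.
apply: cvgD; last by apply: cvgM; exact: cvg_id.
by apply: cvgD; [exact: cvg_cst|apply: cvgN; exact: cvg_id].
Qed.

Lemma continuous_at_gt0 (g : R -> R) (x : R) : {for x, continuous g} -> 0 < g x ->
  exists2 d : R, 0 < d & forall y, `|x - y| < d -> 0 < g y.
Proof.
move=> gc gx.
have : \forall y \near x, 0 < g y by exact: (cvgr_gt (g x) gc 0 gx).
move=> /nbhs_ballP[d /= d0 h].
by exists d.
Qed.

Lemma supercritical_lt1 b s : 0 < b -> 1 / 2 <= s -> supercritical b s -> s < 1.
Proof.
move=> b0 s12 [N [M [N0 h]]]; rewrite ltNge; apply/negP => s1.
have := wsum_anti M N _ _ s1; have := wsum_at1_le2 (R := R) M N.
have := expR_ge1Dx (N.+1%:R * (b * lower_exponent s)).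
have : 0 < N.+1%:R * (b * lower_exponent s).
  by apply: mulr_gt0 => //; apply: mulr_gt0 => //; apply: lower_exponent_gt0; lra.
lra.
Qed.

Lemma supercritical_le b b' s : 0 < s -> b <= b' ->
  supercritical b' s -> supercritical b s.
Proof.
move=> s0 bb' [N [M [N0 h]]]; exists N, M; split => //; apply: le_lt_trans h.
rewrite ler_wpM2l// ler_expR ler_wpM2l// ler_wpM2r//.
exact: ltW (lower_exponent_gt0 _ s0).
Qed.

Lemma supercritical_open b s : 1 / 2 <= s -> supercritical b s ->
  exists s' b', [/\ s < s', b < b' & supercritical b' s'].
Proof.
move=> s12 [N [M [N0 h]]].
(* The rate and the exponent are moved together, by the same [t - s], so that continuity in one
   variable is enough. *)
pose g t := wsum M N t - 64 * expR (N.+1%:R * ((b + (t - s)) * lower_exponent t)).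
have gc : {for s, continuous g}.
  apply: cvgB; first exact: continuous_wsum.
  apply: cvgM; first exact: cvg_cst.
  apply: continuous_comp; last exact: continuous_expR.
  apply: cvgM; first exact: cvg_cst.
  apply: cvgM; last by apply: continuous_lower_exponent; lra.
  apply: cvgD; first exact: cvg_cst.
  by apply: cvgD; [exact: cvg_id|exact: cvg_cst].
have [|d d0 gd] := continuous_at_gt0 _ _ gc; first by rewrite /g subrr addr0 subr_gt0.
exists (s + d / 2), (b + d / 2); split; [lra|lra|].
exists N, M; split=> //.
have := gd (s + d / 2); rewrite /g subr_gt0.
have -> : s + d / 2 - s = d / 2 by ring.
apply; rewrite opprD addrA subrr add0r normrN gtr0_norm; lra.
Qed.

(** At $s = 1/2$ the sum over one-letter words is a harmonic sum, which exceeds any bound as [M]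
    grows. *)
Lemma supercritical_half b : supercritical b (1 / 2).
Proof.
pose X := 64 * expR (2 * (b * lower_exponent (1 / 2))) : R.
exists 1, (Num.truncn (expR X)); split=> //.
have -> : wsum (Num.truncn (expR X)) 1 (1 / 2 : R) =
    \sum_(a <- iota 1 (Num.truncn (expR X))) (a%:R : R) `^ (- 1).
  by rewrite wsum1; apply: eq_bigr => a _; congr (_ `^ (- _)); lra.
apply: lt_le_trans (ln_le_harmonic _).
by rewrite -[X in X < _]expRK ltr_ln ?posrE ?expR_gt0 ?ltr0n// truncnS_gt.
Qed.

Lemma not_subcritical b s : 0 < b -> 1 / 2 < s < 1 -> ~ subcritical b s ->
  supercritical b s.
Proof.
move=> b0 s1 hU; have s0 : 0 < s by case/andP: s1; lra.
have f0 := lower_exponent_gt0 _ s0; have lu := lower_lt_upper_exponent _ s1.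
have u0 := upper_exponent_gt0 _ s0.
set l := lower_exponent s in f0 lu; set u := upper_exponent s in lu u0.
(* [b1 * u] is halfway between [b * l] and [b * u]. Its excess [c] over [b * l], accumulated over
   [n] digits, pays for the constant 64 and the extra digit. *)
pose b1 := b * ((l + u) / 2) / u.
have b1u : b1 * u = b * ((l + u) / 2) by rewrite /b1 divfK// lt0r_neq0.
have b10 : 0 < b1 < b.
  have p : 0 < b * ((l + u) / 2) by rewrite pmulr_rgt0//; lra.
  by rewrite /b1 divr_gt0//= ltr_pdivrMr// ltr_pM2l//; lra.
pose c := b * (u - l) / 2; have c0 : 0 < c by rewrite divr_gt0// pmulr_rgt0//; lra.
pose n := (Num.truncn ((64 + b * l) / c)).+1.
have nc : 64 + b * l <= n%:R * c by rewrite -ler_pdivrMr// ltW// truncnS_gt.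
have [M hM] : exists M, expR (n%:R * (b1 * u)) < wsum M n s.
  apply: contrapT => h; apply: hU; exists n, b1; split => // M.
  by rewrite leNgt; apply/negP => h'; apply: h; exists M.
exists n, M; split=> //; apply: le_lt_trans hM.
have h64 : 64 <= expR 64 :> R by have := expR_ge1Dx (64 : R); lra.
apply: le_trans (ler_wpM2r (expR_ge0 _) h64) _.
rewrite -expRD ler_expR b1u -/l -natr1; move: nc; rewrite /c; lra.
Qed.

Lemma subcritical1 b : 0 < b -> subcritical b 1.
Proof.
move=> b0; pose n := (Num.truncn (4 / b)).+1.
have nb : 4 / b <= n%:R by rewrite ltW// truncnS_gt.
exists n, (b / 2); split => //; first by apply/andP; split; lra.
move=> M; apply: le_trans (wsum_at1_le2 _ _) _.
apply: le_trans (expR_ge1Dx _).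
have -> : upper_exponent 1 = 1 / 2 :> R by rewrite /upper_exponent expr1n subrr add0r mulr1.
by move: nb; rewrite ler_pdivrMr//; lra.
Qed.

(** For fixed [M] continuity in $s$ is clear, but the neighbourhood must not depend on [M].
    Interpolation between [s0] and a fixed [s'] in $(1/2, s_0)$, where all sums are at most
    [Z ^+ n], gives a continuous bound free of [M]. *)
Lemma subcritical_left_open b s0 : 1 / 2 < s0 -> subcritical b s0 ->
  exists2 d : R, 0 < d & forall s, s0 - d < s <= s0 -> subcritical b s.
Proof.
move=> s12 [n [b1 [n0 /andP[b10 b1b] hM]]].
pose b2 := (b1 + b) / 2; pose s' := (1 / 2 + s0) / 2.
have [Z Z1 hZ] : exists2 Z : R, 1 <= Z & forall M n, wsum M n s' <= Z ^+ n.
  by apply: wsum_bounded; rewrite /s'; lra.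
pose R0 := expR (n%:R * (b1 * upper_exponent s0)).
pose R1 := expR (n%:R * (b2 * upper_exponent s0)).
have R01 : 0 < R1 - R0.
  rewrite subr_gt0 ltr_expR ltr_pM2l ?ltr0n// ltr_pM2r ?upper_exponent_gt0//; last lra.
  rewrite /b2; lra.
have Zn0 : 0 < Z ^+ n by rewrite exprn_gt0//; lra.
have s's0 : 0 < s0 - s' by rewrite /s'; lra.
(* Then [K * (s0 - s')] is [Z ^+ n / (R1 - R0)], and $e^x > x$ makes the term from [s'] smaller than
   the slack [R1 - R0] at [s0]. *)
pose K := Z ^+ n / ((R1 - R0) * (s0 - s')).
have K0 : 0 < K by rewrite divr_gt0// mulr_gt0.
pose g s := expR (n%:R * (b2 * upper_exponent s)) -
  (expR (K * (s0 - s)) * R0 + expR (- K * (s - s')) * Z ^+ n).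
have gc : {for s0, continuous g}.
  apply: cvgB.
    apply: continuous_comp; last exact: continuous_expR.
    apply: cvgM; first exact: cvg_cst.
    apply: cvgM; first exact: cvg_cst.
    exact: continuous_upper_exponent.
  apply: cvgD; (apply: cvgM; last exact: cvg_cst);
    (apply: continuous_comp; last exact: continuous_expR);
    (apply: cvgM; first exact: cvg_cst).
  - by apply: cvgD; [exact: cvg_cst|apply: cvgN; exact: cvg_id].
  - by apply: cvgD; [exact: cvg_id|exact: cvg_cst].
have [|d d0 gd] := continuous_at_gt0 _ _ gc.
  rewrite /g subrr mulr0 expR0 mul1r -/R1.
  suff : expR (- K * (s0 - s')) * Z ^+ n < R1 - R0 by lra.
  rewrite mulNr expRN mulrC ltr_pdivrMr ?expR_gt0//.
  have : K * (s0 - s') = Z ^+ n / (R1 - R0).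
    by rewrite /K; field; rewrite !lt0r_neq0.
  move=> ->; have := expR_ge1Dx (Z ^+ n / (R1 - R0)).
  rewrite -(ler_pM2l R01) mulrDr mulr1 mulrCA divff ?lt0r_neq0// mulr1; lra.
exists (Num.min d (s0 - s')); first by rewrite lt_min d0.
move=> s /andP[]; rewrite ltrBlDr -ltrBlDl lt_min => /andP[h1 h2] ss0.
exists n, b2; split => //; first by rewrite /b2; apply/andP; split; lra.
move=> M; have := gd s; rewrite ger0_norm ?subr_ge0// /g subr_gt0 => /(_ h1) hg.
apply: le_trans (ltW hg); apply: le_trans (_ : _ <= _) _.
  apply: (wsum_interpolation _ _ K s' s s0); rewrite ?ss0 ?(ltW K0)//.
  by rewrite andbT; lra.
by apply: lerD; rewrite ler_wpM2l ?expR_ge0.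
Qed.

(** At the supremum [s0] of the supercritical exponents, openness to the right excludes
    supercriticality, so [s0] is subcritical. So are the exponents just below it, and some of those
    are supercritical. *)
Lemma exists_intermediate_exponent b : 0 < b ->
  exists s, [/\ 1 / 2 < s < 1, subcritical b s & supercritical b s].
Proof.
move=> b0; pose S := [set s : R | 1 / 2 <= s /\ supercritical b s].
have hS : has_sup S.
  split; first by exists (1 / 2); split => //; exact: supercritical_half.
  by exists 1 => s [s12 /supercritical_lt1]; move/(_ b0 s12)/ltW.
pose s0 := sup S.
have ubS s : S s -> s <= s0 by exact: sup_upper_bound.
have s0h : 1 / 2 < s0.
  have [s [b' [hs hb hsb]]] := supercritical_open _ _ (lexx _) (supercritical_half b).
  apply: (lt_le_trans hs); apply: ubS; split; first exact: (ltW hs).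
  by apply: supercritical_le hsb; rewrite ?(ltW hb)//; lra.
have s01 : s0 <= 1.
  by apply: ge_sup; [case: hS|move=> s [s12 /supercritical_lt1]; move/(_ b0 s12)/ltW].
have nS : ~ supercritical b s0.
  move=> h; have [s [b' [hs hb hsb]]] := supercritical_open _ _ (ltW s0h) h.
  have : s <= s0; last by rewrite leNgt hs.
  apply: ubS; split; first exact: (ltW (lt_trans s0h hs)).
  by apply: supercritical_le hsb; rewrite ?(ltW hb)//; lra.
have U0 : subcritical b s0.
  move: s01; rewrite le_eqVlt => /orP[/eqP->|s01]; first exact: subcritical1.
  by apply: contrapT => h; apply: nS; apply: not_subcritical; rewrite ?s0h.
have [d d0 hd] := subcritical_left_open _ _ s0h U0.
have [|s [s12 Ss] hs] := @sup_adherent R S (Num.min d (s0 - 1 / 2)) _ hS.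
  by rewrite lt_min d0; lra.
move: hs; rewrite -/s0 ltrBlDr -ltrBlDl lt_min => /andP[h1 h2].
exists s; split => //; last by apply: hd; rewrite ubS// andbT; lra.
by rewrite (supercritical_lt1 b s b0 s12 Ss) andbT; lra.
Qed.

End Gap.

(** * Bounds for the Hausdorff dimension *)

Section HausdorffDimension.
Context {R : realType}.
Implicit Types (A : set R) (s r x y : R).

Lemma diameter_ge0 A : (0 <= diameter A)%E.
Proof. by apply: ereal_sup_ubound; left. Qed.

Lemma diameter_ge A x y : A x -> A y -> (`|x - y|%:E <= diameter A)%E.
Proof. by move=> Ax Ay; apply: ereal_sup_ubound; right; exists (x, y). Qed.

Lemma diameter_le A r : 0 <= r -> (forall x y, A x -> A y -> `|x - y| <= r) ->
  (diameter A <= r%:E)%E.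
Proof.
move=> r0 h; apply: ge_ereal_sup => _ [->|[[x y] [/= Ax Ay] <-]].
  by rewrite lee_fin.
by rewrite lee_fin h.
Qed.

Lemma diam_pow_ge0 s A : (0 <= diam_pow s A)%E.
Proof. by rewrite /diam_pow; case: ifP => // _; exact: poweR_ge0. Qed.

Lemma diam_pow_le s A r : 0 <= s -> 0 <= r ->
  (forall x y, A x -> A y -> `|x - y| <= r) -> (diam_pow s A <= (r `^ s)%:E)%E.
Proof.
move=> s0 r0 h; rewrite /diam_pow; case: ifP => _; first by rewrite lee_fin powR_ge0.
rewrite -poweR_EFin; apply: gt0_ler_poweR => //.
- by rewrite in_itv /= diameter_ge0 leey.
- by rewrite in_itv /= lee_fin r0 leey.
- exact: diameter_le.
Qed.

Lemma hausdorff_premeasure_ge0 s d A : (0 <= hausdorff_premeasure s d A)%E.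
Proof.
apply: le_ereal_inf_tmp => _ [U _ <-].
by apply: nneseries_ge0 => n _ _; exact: diam_pow_ge0.
Qed.

(** A single term is bounded by the whole sum, so a total below $d^s$ forces all diameters below
    $d$: the sum itself controls the mesh. Finite sums over duplicate-free lists stand for the
    series over the index type. *)
Lemma hausdorff_dim_le s A : 0 < s ->
  (forall e : R, 0 < e -> exists (T : countType) (U : T -> set R) (g : T -> R),
    [/\ A `<=` \bigcup_t U t, forall t, 0 <= g t,
      forall t x y, U t x -> U t y -> `|x - y| `^ s <= g t &
      forall l : seq T, uniq l -> \sum_(t <- l) g t <= e]) ->
  (hausdorff_dim A <= s%:E)%E.
Proof.
move=> s0 hA; apply: ereal_inf_lbound; exists s => //; split; first exact: ltW.
suff h (d : R) : 0 < d -> hausdorff_premeasure s d A = 0%E.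
  apply/eqP; rewrite eq_le; apply/andP; split.
    by apply: ge_ereal_sup => _ [d /= d0 <-]; rewrite h.
  by apply: ereal_sup_ubound; exists 1; rewrite /= ?h.
move=> d0; apply/eqP; rewrite eq_le hausdorff_premeasure_ge0 andbT.
apply/lee_addgt0Pr => /= e e0; rewrite add0e.
have ds0 : 0 < d `^ s by rewrite powR_gt0.
have [|T [U [g [AU g0 Ug gl]]]] := hA (Num.min e (d `^ s)).
  by rewrite lt_min e0.
pose r t := g t `^ s^-1.
have rs t : r t `^ s = g t by rewrite -powRrM mulVf ?gt_eqF// powRr1.
have Ur t x y : U t x -> U t y -> `|x - y| <= r t.
  move=> Ux Uy; have := Ug _ _ _ Ux Uy; rewrite -rs => h.
  rewrite leNgt; apply/negP => h'.
  have : r t `^ s < `|x - y| `^ s by rewrite gt0_ltr_powR// nnegrE ?powR_ge0.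
  by rewrite ltNge h.
pose V i := if @pickle_inv T i is Some t then U t else set0.
apply: ge_ereal_inf; exists (\sum_(0 <= i <oo) diam_pow s (V i))%E.
  exists V => //; split=> [x /AU[t _ Ux]|i].
    by exists (pickle t) => //; rewrite /V pickleK_inv.
  rewrite /V; case: pickle_inv => [t|]; last first.
    by apply: diameter_le => //; exact: ltW.
  apply: (@le_trans _ _ (r t)%:E); first by apply: diameter_le; [exact: powR_ge0|exact: Ur].
  rewrite lee_fin leNgt; apply/negP => h.
  have : d `^ s < r t `^ s by rewrite gt0_ltr_powR// nnegrE ?powR_ge0// ltW.
  rewrite rs ltNge; have := gl [:: t] isT.
  by rewrite big_seq1 le_min => /andP[_ ->].
apply: lime_le; first by apply: is_cvg_nneseries => n _ _; exact: diam_pow_ge0.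
apply: nearW => k.
apply: (@le_trans _ _ (\sum_(t <- pmap (@pickle_inv T) (iota 0 k)) g t)%:E); last first.
  rewrite lee_fin; apply: (@le_trans _ _ (Num.min e (d `^ s))); last by rewrite ge_min lexx.
  by apply: gl; rewrite (pmap_uniq (@pickle_invK T)) ?iota_uniq.
rewrite big_pmap -sumEFin /index_iota subn0; apply: lee_sum => i _.
rewrite /V; case: pickle_inv => [t|] /=.
  by rewrite -rs; apply: diam_pow_le; [exact: ltW|exact: powR_ge0|exact: Ur].
by rewrite /diam_pow; case: ifPn => // /asboolP.
Qed.

(* Mass distribution principle, with Lebesgue measure on [0, 1) as the mass. *)
Lemma hausdorff_dim_ge s (C : R) A (f : R -> R) : 0 < s -> 0 < C ->
  (forall y, 0 <= y < 1 -> A (f y)) ->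
  (forall y y', 0 <= y < 1 -> 0 <= y' < 1 -> `|y - y'| <= C * `|f y - f y'| `^ s) ->
  (s%:E <= hausdorff_dim A)%E.
Proof.
move=> s0 C0 fA fC; apply: le_ereal_inf_tmp => _ [t [t0 Ht] <-].
rewrite lee_fin leNgt; apply/negP => ts.
suff : ((2 * C)^-1%:E <= hausdorff_measure t A)%E.
  by rewrite Ht lee_fin leNgt invr_gt0 mulr_gt0.
(* With diameters at most 1 the exponent may be lowered from [s] to [t]. *)
apply: (@le_trans _ _ (hausdorff_premeasure t 1 A)); last first.
  by apply: ereal_sup_ubound; exists 1 => //=.
apply: le_ereal_inf_tmp => _ [U [AU Ud] <-].
have dfin i : diam_pow t (U i) \is a fin_num.
  rewrite ge0_fin_numE ?diam_pow_ge0// /diam_pow; case: ifP => // _.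
  by rewrite poweR_lty// (le_lt_trans (Ud i))// ltry.
pose r i := C * fine (diam_pow t (U i)).
pose P i y := 0 <= y < 1 /\ U i (f y).
have hP i y y' : P i y -> P i y' -> `|y - y'| <= r i.
  move=> [y01 Uy] [y'01 Uy']; apply: le_trans (fC _ _ y01 y'01) _.
  rewrite ler_pM2l// -lee_fin fineK// /diam_pow.
  case: ifPn => [/asboolP U0|_]; first by move: Uy; rewrite U0.
  have h := diameter_ge _ _ _ Uy Uy'; have h1 := Ud i.
  have hle1 : `|f y - f y'| <= 1 by rewrite -lee_fin; exact: le_trans h h1.
  apply: (@le_trans _ _ (`|f y - f y'| `^ t)%:E).
    rewrite lee_fin; have [->|n0] := eqVneq `|f y - f y'| 0.
      by rewrite powR0 ?gt_eqF// powR_ge0.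
    by apply: ger_powR; rewrite ?hle1 ?andbT ?ltW// lt_neqAle eq_sym n0 normr_ge0.
  rewrite -poweR_EFin; apply: gt0_ler_poweR => //.
  - by rewrite in_itv /= lee_fin normr_ge0 leey.
  - by rewrite in_itv /= diameter_ge0 leey.
(* The set of [y] with [f y] in [U i] need not be measurable; the closed interval of radius [r i]
   about one of its points contains it. *)
pose V i := if pselect (exists y, P i y) is left e
  then `[projT1 (cid e) - r i, projT1 (cid e) + r i]%classic else set0.
have r0 i : 0 <= r i by rewrite mulr_ge0 ?fine_ge0 ?diam_pow_ge0 ?ltW.
have VE i : (lebesgue_measure (V i) <= (2 * C)%:E * diam_pow t (U i))%E.
  rewrite /V; case: pselect => [e|_]; last first.
    by rewrite measure0 mule_ge0// ?diam_pow_ge0// lee_fin mulr_ge0// ltW.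
  case: cid => y /= _; rewrite lebesgue_measure_itv /= lte_fin.
  rewrite -[diam_pow t (U i)]fineK// -EFinM -mulrA -/(r i).
  case: ifP => _; last by rewrite lee_fin mulr_ge0.
  by rewrite -EFinB lee_fin; lra.
have mV i : measurable (V i) by rewrite /V; case: pselect.
have cover : (`[0, 1[%classic : set R) `<=` \bigcup_i V i.
  move=> y /=; rewrite in_itv /= => y01.
  have [i _ Ui] := AU _ (fA _ y01); exists i => //.
  rewrite /V; case: pselect => [e|/(_ _)[]]; last by exists y.
  case: cid => z /= Pz; have := hP i y z (conj y01 Ui) Pz.
  by rewrite ler_distl in_itv.
have h : (1%:E <= \sum_(0 <= n <oo) lebesgue_measure (V n))%E.
  have -> : 1%:E = lebesgue_measure (`[0, 1[%classic : set R).
    by rewrite lebesgue_measure_itv /= lte_fin ltr01 -EFinB subr0.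
  exact: (@measure_sigma_subadditive _ _ _ (@lebesgue_measure R) _ V mV
    (measurable_itv _) cover).
rewrite -[X in X%:E]mulr1 EFinM lee_pdivrMl ?mulr_gt0//.
rewrite -nneseriesZl; last by move=> i _; exact: diam_pow_ge0.
by apply: le_trans h _; apply: lee_nneseries.
Qed.

End HausdorffDimension.

(** * Covering the smaller set *)

Section UpperBound.
Context {R : realType}.
Implicit Types (s b : R) (n M : nat).

Lemma ler_sum_uniq_sub (T : eqType) (l L : seq T) (F : T -> R) :
  uniq l -> {subset l <= L} -> (forall t, 0 <= F t) ->
  \sum_(t <- l) F t <= \sum_(t <- L) F t.
Proof.
move=> + + F0; elim: l L => [|x l IH] L; first by rewrite big_nil sumr_ge0.
rewrite [uniq _]/= => /andP[xl ul] lL; rewrite big_cons.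
have xL : x \in L by apply: lL; rewrite mem_head.
rewrite (big_rem _ xL) lerD2l; apply: IH => // y yl.
have := lL y; rewrite inE yl orbT (perm_mem (perm_to_rem xL)) inE => /(_ isT).
by case/orP => // /eqP yx; move: xl; rewrite -yx yl.
Qed.

(** Write $n = k n_0 + r$ with $r < n_0$: the [k] periods use the certificate, and the remainder
    costs at most $Z^{n_0}$. *)
Lemma subcritical_growth b s : 0 < s -> 1 / 2 < s -> subcritical b s ->
  exists b1 C, [/\ 0 < b1 < b, 0 < C &
    forall M n, wsum M n s <= C * expR (n%:R * (b1 * upper_exponent s))].
Proof.
move=> s0 s12 [n0 [b1 [n00 b1b hM]]].
have [Z Z1 hZ] := wsum_bounded _ s12.
have Z0 : 0 < Z by exact: lt_le_trans Z1.
exists b1, (Z ^+ n0); split; rewrite ?exprn_gt0// => M n.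
have u0 := upper_exponent_gt0 _ s0; case/andP: (b1b) => b10 _.
have hk k : wsum M (k * n0) s <= expR ((k * n0)%:R * (b1 * upper_exponent s)).
  elim: k => [|k IH]; first by rewrite mul0n mul0r expR0; exact: hZ _ 0%N.
  rewrite mulSn; apply: le_trans (wsum_cat_le _ _ _ _ (ltW s0)) _.
  by rewrite natrD mulrDl expRD ler_pM ?wsum_ge0.
rewrite {1}(divn_eq n n0); apply: le_trans (wsum_cat_le _ _ _ _ (ltW s0)) _.
rewrite mulrC; apply: ler_pM; rewrite ?wsum_ge0//.
  apply: le_trans (hZ _ _) _; apply: ler_weXn2l => //.
  by rewrite ltnW// ltn_mod.
apply: le_trans (hk _) _; rewrite ler_expR ler_wpM2r//.
  exact: mulr_ge0 (ltW b10) (ltW u0).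
by rewrite ler_nat leq_divM.
Qed.

(* [3 s / 2 = pexp s - (1 - s)^2] with [pexp s > 1], so that the sum of
   [a^(-3 s / 2)] over [a <= X] is at most a constant times [X^((1 - s)^2)]. *)
Let pexp s : R := 1 + s * (s - 1 / 2).

Let hwt s (a : nat) : R := if a is 0%N then 1 else a%:R `^ (- pexp s).

(* The pair [(w, a)] with [a > 0] stands for the points with prefix [w ++ [:: a]]
   and a large next digit, and [(w, 0)] for those with a very large digit after [w]. *)
Let Ucover s b (m0 : nat) (t : seq nat * nat) : set R :=
  let tau := (size t.1).+1%:R * b in
  let al := upper_exponent s / s in
  if ~~ ((m0 <= size t.1)%N && pos_word t.1) then set0
  else if t.2 is 0%N then
    [set x | exists2 y, 0 <= y <= expR (- (al * tau)) /\ y <= 1 & x = cf t.1 y]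
  else if ln (t.2%:R) <= al * tau then
    [set x | exists2 z, 0 <= z <= expR ((ln t.2%:R - tau) / 2) /\ z <= 1 &
      x = cf (t.1 ++ [:: t.2]) z]
  else set0.

Let gcover s b (m0 : nat) (t : seq nat * nat) : R :=
  if ~~ ((m0 <= size t.1)%N && pos_word t.1) then 0
  else cfq t.1 `^ (- (2 * s)) *
    expR (- (upper_exponent s * ((size t.1).+1%:R * b))) * hwt s t.2.

(** This balance is the origin of [upper_exponent]. With threshold $e^{\alpha\tau}$ for $a_n$, the
    set for large digits contributes $e^{-\alpha s\tau}$ and the sets for small ones
    $e^{\alpha\tau(1-s)^2 - s\tau/2}$, relative to $q^{-2s}$; both equal $e^{-u\tau}$ for $\alpha =
    u/s$. *)
Lemma upper_exponent_cover_eq s : 0 < s ->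
  (upper_exponent s / s) * ((1 - s) ^+ 2 + s) = s / 2.
Proof.
move=> s0; rewrite /upper_exponent; have := sqr_ge0 (s - 1 / 2) => h.
have p : 0 < 1 - s + s ^+ 2 by move: h; rewrite !expr2; lra.
have -> : (1 - s) ^+ 2 + s = 1 - s + s ^+ 2 by ring.
by field; rewrite !lt0r_neq0.
Qed.

Let cover_diam s b m0 t x y : 0 < s -> 0 < b -> Ucover s b m0 t x -> Ucover s b m0 t y ->
  `|x - y| `^ s <= gcover s b m0 t.
Proof.
case: t => w a s0 b0; rewrite /Ucover /gcover /=; case: ifP => //= /negbFE/andP[_ pw].
set tau := _ * b; set u := upper_exponent s.
have tau0 : 0 < tau by rewrite mulr_gt0.
have q0 := cfq_gt0 (R := R) _ pw.
have dist (v : seq nat) (p q rho : R) : pos_word v ->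
    0 <= p <= expR rho /\ p <= 1 -> 0 <= q <= expR rho /\ q <= 1 ->
    `|cf v p - cf v q| <= expR (rho - 2 * ln (cfq v)).
  move=> pv [/andP[p0 pr] p1] [/andP[q0' qr] q1].
  apply: le_trans (cf_dist_le _ _ _ pv _ _) _; rewrite ?p0 ?q0'//.
  have qv := cfq_gt0 (R := R) _ pv.
  rewrite expRD expRN.
  have -> : expR (2 * ln (cfq v)) = cfq v ^+ 2 :> R.
    by rewrite expRM_natl lnK// posrE.
  by rewrite ler_wpM2r ?invr_ge0 ?sqr_ge0// ler_norml; apply/andP; split; lra.
case: a => [|a] /=.
  move=> [p hp ->] [q hq ->]; rewrite mulr1.
  have h := dist w p q _ pw hp hq.
  apply: (@le_trans _ _ (expR (- (u / s * tau) - 2 * ln (cfq w)) `^ s)).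
    by apply: ge0_ler_powR; rewrite ?nnegrE ?expR_ge0 ?(ltW s0).
  rewrite -expRM powR_expR// -expRD ler_expR.
  have -> : u / s * tau = u * tau / s by rewrite mulrAC.
  by rewrite mulrDl mulNr divfK ?gt_eqF//; lra.
case: ifP => // hla [p hp ->] [q hq ->].
have a0 : (0 : R) < a.+1%:R by rewrite ltr0n.
have pwa : pos_word (w ++ [:: a.+1]) by rewrite pos_word_cat pw.
have h := dist _ p q _ pwa hp hq.
have lq : ln (cfq w) + ln (a.+1%:R) <= ln (cfq (w ++ [:: a.+1])) :> R.
  rewrite -lnM ?posrE// ler_ln ?posrE ?mulr_gt0 ?cfq_gt0//.
  by rewrite -{1}(cfq1 a.+1) cfq_cat_ge.
set la := ln _ in hla h lq.
have la0 : 0 <= la by rewrite ln_ge0// ler1n.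
apply: (@le_trans _ _ (expR ((la - tau) / 2 - 2 * (ln (cfq w) + la)) `^ s)).
  apply: ge0_ler_powR; rewrite ?nnegrE ?expR_ge0 ?(ltW s0)//.
  by apply: le_trans h _; rewrite ler_expR; lra.
rewrite -expRM !powR_expR// -/la -!expRD ler_expR.
have E := upper_exponent_cover_eq _ s0; rewrite -/u in E.
(* The threshold on the digit turns the missing factor $a^{(1-s)^2}$ into a power of $e^\tau$. *)
have hk : (1 - s) ^+ 2 * la <= (1 - s) ^+ 2 * (u / s * tau) by rewrite ler_wpM2l ?sqr_ge0.
have E2 : (u / s * tau) * (1 - s) ^+ 2 + u * tau = s / 2 * tau.
  by rewrite -E; field; rewrite gt_eqF.
have -> : - pexp s * la = - ((1 - s) ^+ 2 * la) - 3 / 2 * s * la + 0.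
  by rewrite /pexp; field.
lra.
Qed.

Lemma infinite_set_nat_ge (A : set nat) : infinite_set A ->
  forall k, exists2 n, (k <= n)%N & A n.
Proof.
move=> Ainf k; apply: contrapT => h; apply: Ainf.
apply: (@sub_finite_set _ _ `I_k) => // n An /=.
by rewrite ltnNge; apply/negP => kn; apply: h; exists n.
Qed.

Let cover_E12 s b m0 (Psi : nat -> R) :
  (forall n, (m0 < n)%N -> expR (n%:R * b) <= Psi n) ->
  E_set 1 2 Psi `<=` \bigcup_t Ucover s b m0 t.
Proof.
move=> hPsi x [x01 xinf].
have [[//|m] mm [_ hm]] := infinite_set_nat_ge _ xinf m0.+1.
have hb := le_trans (hPsi _ mm) hm.
set a := partial_quotient m.+1 x in hb; set c := partial_quotient m.+2 x in hb.
(* A digit 0 marks the end of a finite expansion. Positivity of the product rules it out at both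
   places, so the tails [y] and [z] below are positive. *)
have p0 : 0 < (a%:R : R) `^ 1 * c%:R `^ 2 by exact: lt_le_trans (expR_gt0 _) hb.
have a0 : (0 < a)%N.
  by rewrite lt0n; apply: contraTneq p0 => ->; rewrite powR0// mul0r ltxx.
have c0 : (0 < c)%N.
  by rewrite lt0n; apply: contraTneq p0 => ->; rewrite [X in _ * X]powR0// mulr0 ltxx.
pose y := iter m (@gauss_map R) x.
have y01 : 0 <= y < 1.
  by rewrite /y; case: (m) => // k; rewrite iterS gauss_map_itv.
have inv_gt0 (z : R) : 0 <= z < 1 -> (0 < Num.truncn z^-1)%N -> 0 < z.
  move=> /andP[z0 _] hz; rewrite lt_neqAle z0 andbT eq_sym.
  by apply: contraTneq hz => ->; rewrite invr0 truncn0.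
have y0 : 0 < y by exact: inv_gt0.
have [w [sw pw xw]] := cf_iter_gauss_map m x x01 y0.
pose z := gauss_map y.
have yE : y = (a%:R + z)^-1.
  by have [|_] := cf_truncn_gauss_map y; first by rewrite y0; case/andP: y01.
have z01 : 0 <= z < 1 by exact: gauss_map_itv.
have z0 : 0 < z by exact: inv_gt0.
have hz : z <= c%:R^-1.
  rewrite -[leLHS]invrK lef_pV2 ?posrE ?invr_gt0 ?ltr0n//.
  by rewrite truncn_le invr_ge0 ltW.
clearbody a.
exists (w, if ln (a%:R) <= upper_exponent s / s * (m.+1%:R * b) then a else 0%N) => //.
rewrite /Ucover /= sw pw -[(m0 <= m)%N]/(m0 < m.+1)%N mm /=.
have aR : (0 : R) < a%:R by rewrite ltr0n.
have cR : (0 : R) < c%:R by rewrite ltr0n.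
case: ifPn => [hla|].
  case: a a0 hla yE aR hb {p0} => // a _ hla yE aR hb; rewrite hla.
  exists z; last by rewrite cf_cat /= -yE.
  rewrite (ltW z0) (ltW (proj2 (andP z01))); split => //=.
  apply: le_trans hz _; rewrite -{1}(@lnK _ c%:R) ?posrE// -expRN ler_expR.
  move: hb; rewrite powRr1 ?(ltW aR)// powR_expR// -{1}(@lnK _ a.+1%:R) ?posrE//.
  by rewrite -expRD ler_expR; lra.
rewrite -ltNge => hla; exists y; last exact: xw.
rewrite (ltW y0) (ltW (proj2 (andP y01))); split => //=.
rewrite yE; apply: (@le_trans _ _ a%:R^-1).
  rewrite lef_pV2 ?posrE//; last exact: addr_gt0.
  by rewrite lerDl ltW.
by rewrite -(@lnK _ a%:R) ?posrE// -expRN ler_expR lerN2 ltW.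
Qed.

Lemma sum_geometric_iota (eta : R) m k : 0 <= eta < 1 ->
  \sum_(n <- iota m k) eta ^+ n <= eta ^+ m / (1 - eta).
Proof.
move=> /andP[e0 e1]; elim: k m => [|k IH] m.
  by rewrite big_nil divr_ge0 ?exprn_ge0 ?subr_ge0// ltW.
rewrite big_cons; apply: le_trans (lerD (lexx _) (IH _)) _.
rewrite exprS le_eqVlt; apply/orP; left; apply/eqP; field.
by rewrite subr_eq0 gt_eqF.
Qed.

Let hwt_sum s M : 1 / 2 < s -> \sum_(a <- iota 0 M.+1) hwt s a <= 2 + (pexp s - 1)^-1.
Proof.
move=> s12; rewrite big_cons -[2]/(1 + 1) -addrA lerD2l.
apply: le_trans (pseries_bounded (pexp s) _ M); last first.
  by rewrite /pexp ltrDl mulr_gt0//; lra.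
rewrite !big_seq le_eqVlt; apply/orP; left; apply/eqP; apply: eq_bigr => a.
by rewrite mem_iota; case: a.
Qed.

Let gcover_ge0 s b m0 t : 0 <= gcover s b m0 t.
Proof.
rewrite /gcover; case: ifP => // _; rewrite mulr_ge0 ?mulr_ge0 ?powR_ge0 ?expR_ge0//.
by rewrite /hwt; case: t.2 => // a; exact: powR_ge0.
Qed.

(** Apart from indices of value 0, a finite list lies among words on digits up to some [M], of
    lengths [m0] to [m0 + M]. Summing over the last digit gives the convergent series of exponent
    [pexp s], over words the growth bound, over lengths the geometric series of ratio [eta]. *)
Let gcover_sum s b b1 C m0 (l : seq (seq nat * nat)) : 1 / 2 < s -> 0 < C -> b1 < b ->
  (forall M n, wsum M n s <= C * expR (n%:R * (b1 * upper_exponent s))) -> uniq l ->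
  0 < b -> forall eta, eta = expR (- (upper_exponent s * (b - b1))) ->
  \sum_(t <- l) gcover s b m0 t <= (2 + (pexp s - 1)^-1) * C * (eta ^+ m0 / (1 - eta)).
Proof.
move=> s12 C0 b1b hC ul b0 eta etaE; have s0 : 0 < s by lra.
have u0 := upper_exponent_gt0 _ s0.
pose M := \max_(t <- l) maxn (maxn (size t.1) t.2) (\max_(a <- t.1) a).
pose L := [seq (w, a) | w <- flatten [seq words M n | n <- iota m0 M.+1], a <- iota 0 M.+1].
pose ok (t : seq nat * nat) := (m0 <= size t.1)%N && pos_word t.1.
have -> : \sum_(t <- l) gcover s b m0 t = \sum_(t <- [seq t <- l | ok t]) gcover s b m0 t.
  rewrite big_filter (bigID ok) /= [X in _ + X]big1 ?addr0// => t /negbTE nt.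
  by rewrite /gcover -/(ok t) nt.
have sub : {subset [seq t <- l | ok t] <= L}.
  move=> [w a]; rewrite mem_filter => /andP[/andP[/= m0w pw] tl].
  have := @leq_bigmax_seq _ l xpredT
    (fun t => maxn (maxn (size t.1) t.2) (\max_(a <- t.1) a)) _ tl isT.
  rewrite /= -/M !geq_max => /andP[/andP[swM aM] wM].
  apply/allpairsP; exists (w, a); split; [|by rewrite mem_iota add0n ltnS|by []].
  apply/flattenP; exists (words M (size w)); first
    by apply: map_f; rewrite mem_iota m0w ltn_addl// ltnS.
  rewrite mem_words eqxx /=; apply/allP => d dw; apply/andP; split.
    by move/allP: pw; exact.
  by apply: leq_trans wM; exact: (@leq_bigmax_seq _ w xpredT id).
apply: le_trans (ler_sum_uniq_sub _ _ _ _ (filter_uniq _ ul) sub (gcover_ge0 _ _ _)) _.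
have eta01 : 0 <= eta < 1.
  by rewrite etaE expR_ge0 /= -expR0 ltr_expR oppr_lt0 mulr_gt0// subr_gt0.
apply: le_trans
  (_ : (2 + (pexp s - 1)^-1) * C * \sum_(n <- iota m0 M.+1) eta ^+ n <= _);
  last first.
  rewrite ler_wpM2l ?sum_geometric_iota// mulr_ge0 ?(ltW C0)// addr_ge0// invr_ge0 /pexp.
  by rewrite addrC addKr mulr_ge0//; lra.
rewrite big_allpairs_dep big_flatten big_map mulr_sumr.
rewrite big_seq [leRHS]big_seq; apply: ler_sum => n; rewrite mem_iota => /andP[m0n _].
pose D := expR (- (upper_exponent s * (n.+1%:R * b))) : R.
apply: (@le_trans _ _ (wsum M n s * D * (2 + (pexp s - 1)^-1))).
  rewrite /wsum !mulr_suml !big_seq; apply: ler_sum => w wM.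
  have pw := words_pos _ _ _ wM; have sw := words_size _ _ _ wM.
  under eq_bigr do rewrite /gcover /= sw m0n pw /=.
  by rewrite -mulr_sumr ler_wpM2l ?hwt_sum// mulr_ge0 ?powR_ge0 ?expR_ge0.
rewrite mulrC -mulrA ler_wpM2l//.
  by rewrite addr_ge0// invr_ge0 /pexp addrC addKr mulr_ge0//; lra.
apply: le_trans (ler_wpM2r (expR_ge0 _) (hC _ _)) _.
rewrite -mulrA ler_wpM2l ?(ltW C0)// -expRD etaE -expRM_natl ler_expR -natr1.
have : 0 <= upper_exponent s * b by rewrite mulr_ge0 ?ltW.
by move: (upper_exponent s) => u h; nra.
Qed.

Lemma hausdorff_dim_E12_le s b (Psi : nat -> R) : 1 / 2 < s -> subcritical b s ->
  (forall b1, b1 < b -> exists n0, forall n, (n0 <= n)%N -> expR (n%:R * b1) <= Psi n) ->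
  (hausdorff_dim (E_set 1 2 Psi) <= s%:E)%E.
Proof.
move=> s12 sb hPsi; have s0 : 0 < s by lra.
have [b1 [C [/andP[b10 b1b] C0 hC]]] := subcritical_growth _ _ s0 s12 sb.
have u0 := upper_exponent_gt0 _ s0.
(* Below [b], so that $e^{n b_2}$ eventually bounds [Psi] from below; above [b1], so that the series
   over lengths converges. *)
pose b2 := (b1 + b) / 2; have b12 : b1 < b2 by rewrite /b2; lra.
have b20 : 0 < b2 by lra.
have [|n0 hn0] := hPsi b2; first by rewrite /b2; lra.
apply: hausdorff_dim_le => // e e0.
pose H := 2 + (pexp s - 1)^-1; pose eta := expR (- (upper_exponent s * (b2 - b1))).
have H0 : 0 < H.
  by rewrite /H addr_gt0// invr_gt0 /pexp addrC addKr mulr_gt0//; lra.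
have c0 : 0 < upper_exponent s * (b2 - b1) by rewrite pmulr_rgt0//; lra.
have eta1 : 0 < 1 - eta by rewrite subr_gt0 -expR0 ltr_expR oppr_lt0.
pose X := H * C / ((1 - eta) * e).
have X0 : 0 < X by rewrite divr_gt0// mulr_gt0.
pose m0 := maxn n0 (Num.truncn (X / (upper_exponent s * (b2 - b1)))).+1.
have hm0 : H * C * (eta ^+ m0 / (1 - eta)) <= e.
  have : eta ^+ m0 <= X^-1.
    rewrite -expRM_natl mulrN expRN lef_pV2 ?posrE ?expR_gt0//.
    apply: le_trans (expR_ge1Dx _); apply: ler_wpDl => //.
    rewrite -ler_pdivrMr//; apply: le_trans (ltW (truncnS_gt _)) _.
    by rewrite ler_nat leq_maxr.
  rewrite /X invf_div ler_pdivlMr ?mulr_gt0// => h.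
  rewrite mulrA ler_pdivrMr//; lra.
exists (seq nat * nat)%type, (Ucover s b2 m0), (gcover s b2 m0); split.
- apply: cover_E12 => n mn; apply: hn0; apply: leq_trans (ltnW mn); exact: leq_maxl.
- exact: gcover_ge0.
- by move=> t x y; apply: cover_diam.
- by move=> l ul; apply: le_trans hm0; exact: (gcover_sum s b2 b1 C).
Qed.

End UpperBound.

(** * Trees of cylinders *)

Section NestedCylinders.
Context {R : realType}.
Implicit Types (x y z : R) (w : seq nat).

Lemma cf_inj w z z' : pos_word w -> 0 <= z <= 1 -> 0 <= z' <= 1 ->
  cf w z = cf w z' -> z = z'.
Proof.
move=> pw z01 z'01 h; have := cf_dist _ _ _ pw z01 z'01.
have d : 0 < den w z * den w z' by rewrite mulr_gt0 ?den_gt0.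
move/eqP; rewrite h subrr normr0 eq_sym mulf_eq0 invr_eq0 (gt_eqF d).
by rewrite orbF normr_eq0 subr_eq0 => /eqP.
Qed.

Lemma cf_between w z : pos_word w -> 0 <= z <= 1 ->
  Num.min (cf w 0) (cf w 1) <= cf w z <= Num.max (cf w 0) (cf w 1).
Proof.
elim: w z => [|a w IH] z /=; first by move=> _ /andP[z0 z1]; rewrite ge_min le_max z0 z1 orbT.
move=> /andP[a1 pw] z01; have /andP[] := IH z pw z01.
have h0 : 0 <= (0 : R) <= 1 by rewrite lexx ler01.
have h1 : 0 <= (1 : R) <= 1 by rewrite lexx ler01.
have := cf_bounds _ _ pw z01; have := cf_bounds _ _ pw h0; have := cf_bounds _ _ pw h1.
have a1R : 1 <= a%:R :> R by rewrite ler1n.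
move: (cf w 0) (cf w 1) (cf w z) => c0 c1 c /andP[? _] /andP[? _] /andP[? _].
rewrite !ge_min !le_max => H1 H2.
by apply/andP; split; apply/orP; [case/orP: H2|case/orP: H1] => H; [left|right|left|right];
  rewrite lef_pV2 ?posrE; lra.
Qed.

Lemma cf_surjective w x : pos_word w ->
  Num.min (cf w 0) (cf w 1) <= x <= Num.max (cf w 0) (cf w 1) ->
  exists2 z, 0 <= z <= 1 & x = cf w z.
Proof.
elim: w x => [|a w IH] x /=.
  by rewrite min_l ?max_r ?ler01// => _ x01; exists x.
move=> /andP[a1 pw] h.
have h0 : 0 <= (0 : R) <= 1 by rewrite lexx ler01.
have h1 : 0 <= (1 : R) <= 1 by rewrite lexx ler01.
have /andP[c00 _] := cf_bounds _ _ pw h0; have /andP[c10 _] := cf_bounds _ _ pw h1.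
have a1R : 1 <= a%:R :> R by rewrite ler1n.
have x0 : 0 < x.
  by case/andP: h => + _; apply: lt_le_trans; rewrite lt_min !invr_gt0; apply/andP; split; lra.
have [|z z01 hz] := IH (x^-1 - a%:R) pw; last first.
  by exists z => //; rewrite -hz addrC subrK invrK.
have hl u : 0 < u -> (u <= x^-1) = (x <= u^-1).
  by move=> u0; rewrite -{1}(invrK u) lef_pV2 ?posrE ?invr_gt0.
have hr u : 0 < u -> (x^-1 <= u) = (u^-1 <= x).
  by move=> u0; rewrite -{1}(invrK u) lef_pV2 ?posrE ?invr_gt0.
have p0 : 0 < a%:R + cf w 0 :> R by lra.
have p1 : 0 < a%:R + cf w 1 :> R by lra.
move: h; rewrite !ge_min !le_max !lerBrDl !lerBlDl !hl// !hr//.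
by rewrite andbC.
Qed.

(** The closed cylinders are nested intervals, and the supremum of their left ends lies in all of
    them. *)
Lemma nested_cylinders (W v : nat -> seq nat) :
  (forall j, pos_word (W j)) -> (forall j, pos_word (v j)) ->
  (forall j, W j.+1 = W j ++ v j) ->
  exists x, forall j, exists2 z, 0 <= z <= 1 & x = cf (W j) z.
Proof.
move=> pW pv WS.
have h0 : 0 <= (0 : R) <= 1 by rewrite lexx ler01.
have h1 : 0 <= (1 : R) <= 1 by rewrite lexx ler01.
pose lo j : R := Num.min (cf (W j) 0) (cf (W j) 1).
pose hi j : R := Num.max (cf (W j) 0) (cf (W j) 1).
have step j : lo j <= lo j.+1 /\ hi j.+1 <= hi j.
  rewrite /lo /hi WS !cf_cat le_min ge_max.
  have /andP[-> ->] := cf_between _ _ (pW j) (cf_bounds _ _ (pv j) h0).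
  by have /andP[-> ->] := cf_between _ _ (pW j) (cf_bounds _ _ (pv j) h1).
have lohi j : lo j <= hi j by rewrite /lo /hi le_max ge_min lexx.
have lom j k : (j <= k)%N -> lo j <= lo k.
  by move/subnK <-; elim: (k - j)%N => // n IH; apply: le_trans IH _; case: (step (n + j)%N).
have him j k : (j <= k)%N -> hi k <= hi j.
  by move/subnK <-; elim: (k - j)%N => // n IH; apply: le_trans IH; case: (step (n + j)%N).
have lh j k : lo j <= hi k.
  have [jk|/ltnW kj] := leqP j k; first exact: le_trans (lom _ _ jk) (lohi k).
  exact: le_trans (lohi j) (him _ _ kj).
have hs : has_sup (range lo).
  by split; [exists (lo 0%N); exists 0%N|exists (hi 0%N) => _ [j _ <-]].
exists (sup (range lo)) => j; apply: cf_surjective => //; apply/andP; split.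
  by apply: sup_upper_bound => //; exists j.
by apply: ge_sup; [case: hs|move=> _ [k _ <-]; exact: lh].
Qed.

End NestedCylinders.

(** * Coding the unit interval by a tree of words *)

Section Greedy.
Context {R : realType} {T : Type} (x0 : T).
Implicit Types (l : seq T) (F : T -> R).

Definition cumul l F (i : nat) : R := \sum_(w <- take i l) F w.

(** Half-open intervals of lengths [F w] are laid end to end from 0; [i] is the position of one that
    contains [t]. *)
Definition greedy_spec l F (t : R) (i : nat) : Prop :=
  [/\ (i < size l)%N, cumul l F i <= t & t < cumul l F i + F (nth x0 l i)].

Definition greedy l F t : nat := xget 0%N (greedy_spec l F t).

Lemma greedyP l F t : 0 <= t < \sum_(w <- l) F w -> greedy_spec l F t (greedy l F t).
Proof.
move=> ht; suff : exists i, greedy_spec l F t i by move=> [i hi]; exact: (xgetI _ hi).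
elim: l t ht => [|a l IH] t; first by rewrite big_nil => /andP[h /lt_geF]; rewrite h.
rewrite big_cons => /andP[t0 ht].
have [h|h] := ltP t (F a).
  by exists 0%N; split; rewrite ?/cumul //= big_nil ?add0r.
have [|i [il h1 h2]] := IH (t - F a); first by rewrite subr_ge0 h ltrBlDl.
exists i.+1; split => //=; rewrite /cumul /= big_cons.
  by rewrite addrC -lerBrDr.
by move: h2; rewrite ltrBlDl addrA.
Qed.

End Greedy.

Section Tree.
Context {R : realType} (lev : nat -> seq (seq nat)) (wt : nat -> seq nat -> R).
Context (wt_gt0 : forall j w, w \in lev j -> 0 < wt j w).
Context (wt_le : forall j w, w \in lev j -> wt j w <= 1 / 2).
Context (wt_sum : forall j, \sum_(w <- lev j) wt j w = 1).
Context (lev_pos : forall j w, w \in lev j -> pos_word w).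
Context (lev_size : forall j w, w \in lev j -> (0 < size w)%N).
Implicit Types (y : R) (j : nat).

Let gi j t := greedy [::] (lev j) (wt j) t.

(* A point [y] of [0, 1) is expanded greedily: level [j] subdivides the current
   interval in the proportions [wt j].  [tree_t y j] is the relative position of [y]
   in its interval, [tree_mu y j] the length of the interval and [tree_w y j] the
   word that has been read. *)
Fixpoint tree_t y j : R :=
  if j is j'.+1 then
    let t := tree_t y j' in let i := gi j' t in
    (t - cumul (lev j') (wt j') i) / wt j' (nth [::] (lev j') i)
  else y.

Definition tree_i y j : nat := gi j (tree_t y j).
Definition tree_v y j : seq nat := nth [::] (lev j) (tree_i y j).

Fixpoint tree_w y j : seq nat :=
  if j is j'.+1 then tree_w y j' ++ tree_v y j' else [::].
Fixpoint tree_mu y j : R :=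
  if j is j'.+1 then tree_mu y j' * wt j' (tree_v y j') else 1.

Lemma tree_wS y j : tree_w y j.+1 = tree_w y j ++ tree_v y j.
Proof. by []. Qed.

Lemma tree_muS y j : tree_mu y j.+1 = tree_mu y j * wt j (tree_v y j).
Proof. by []. Qed.

Lemma tree_t_itv y j : 0 <= y < 1 -> 0 <= tree_t y j < 1.
Proof.
move=> y01; elim: j => //= j IH.
have [] := @greedyP R _ [::] (lev j) (wt j) (tree_t y j); first by rewrite wt_sum.
rewrite -/(gi _ _) => il h1 h2; have p := wt_gt0 _ _ (mem_nth [::] il).
by rewrite divr_ge0 ?(ltW p) ?subr_ge0//= ltr_pdivrMr// mul1r ltrBlDl.
Qed.

Lemma tree_i_lt y j : 0 <= y < 1 -> (tree_i y j < size (lev j))%N.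
Proof.
move=> /(tree_t_itv _ j) h.
by have [] := @greedyP R _ [::] (lev j) (wt j) (tree_t y j); rewrite ?wt_sum.
Qed.

Lemma tree_v_mem y j : 0 <= y < 1 -> tree_v y j \in lev j.
Proof. by move=> y01; apply/mem_nth/tree_i_lt. Qed.

Lemma tree_tE y j : 0 <= y < 1 ->
  tree_t y j = cumul (lev j) (wt j) (tree_i y j) + wt j (tree_v y j) * tree_t y j.+1.
Proof.
move=> y01; have p := wt_gt0 _ _ (tree_v_mem y j y01).
by rewrite /= -/(tree_i y j) -/(tree_v y j) mulrC divfK ?gt_eqF// addrC subrK.
Qed.

Lemma tree_mu_gt0 y j : 0 <= y < 1 -> 0 < tree_mu y j.
Proof.
move=> y01; elim: j => //= j IH; rewrite mulr_gt0//.
by apply: wt_gt0; exact: tree_v_mem.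
Qed.

Lemma tree_mu_le y j : 0 <= y < 1 -> tree_mu y j <= (1 / 2) ^+ j.
Proof.
move=> y01; elim: j => [|j IH] /=; first by rewrite expr0.
rewrite exprSr ler_pM ?(ltW (tree_mu_gt0 _ _ y01))//; last first.
  by apply: wt_le; exact: tree_v_mem.
by apply/ltW/wt_gt0/tree_v_mem.
Qed.

Lemma tree_w_pos y j : 0 <= y < 1 -> pos_word (tree_w y j).
Proof.
move=> y01; elim: j => //= j IH; rewrite pos_word_cat IH.
by apply: lev_pos; exact: tree_v_mem.
Qed.

Lemma tree_agree y y' j : 0 <= y < 1 -> 0 <= y' < 1 ->
  (forall i, (i < j)%N -> tree_i y i = tree_i y' i) ->
  [/\ tree_w y j = tree_w y' j, tree_mu y j = tree_mu y' j &
      y - y' = tree_mu y j * (tree_t y j - tree_t y' j)].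
Proof.
move=> y01 y'01; elim: j => [|j IH] h; first by split => //; rewrite mul1r.
have [|hw hm hy] := IH; first by move=> i ij; apply: h; exact: ltnW.
have hi := h j (ltnSn j).
have hv : tree_v y j = tree_v y' j by rewrite /tree_v hi.
rewrite !tree_wS !tree_muS hw hm hv; split => //.
rewrite hy hm (tree_tE y)// (tree_tE y')// hi hv; ring.
Qed.

(** If all indices agreed, [tree_agree] would give $|y - y'| \le 2^{-n}$ for every $n$, as each
    weight is at most 1/2. *)
Lemma tree_split y y' : 0 <= y < 1 -> 0 <= y' < 1 -> y != y' ->
  exists2 j, (forall i, (i < j)%N -> tree_i y i = tree_i y' i) &
    tree_i y j != tree_i y' j.
Proof.
move=> y01 y'01 yy'.
have ex : exists j, tree_i y j != tree_i y' j.
  apply: contrapT => h; move/negP: yy'; apply.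
  have hi i : tree_i y i = tree_i y' i.
    by apply/eqP/negPn/negP => hn; apply: h; exists i.
  rewrite -subr_eq0 -normr_eq0 eq_le normr_ge0 andbT leNgt; apply/negP => d0.
  pose n := (Num.truncn `|y - y'|^-1).+1.
  have : `|y - y'| <= n%:R^-1.
    have [_ _ ->] := tree_agree y y' n y01 y'01 (fun i _ => hi i).
    rewrite normrM (gtr0_norm (tree_mu_gt0 _ _ y01)) -[leRHS]mulr1.
    have /andP[? ?] := tree_t_itv _ n y01; have /andP[? ?] := tree_t_itv _ n y'01.
    apply: ler_pM; rewrite ?(ltW (tree_mu_gt0 _ _ y01))//; last first.
      by rewrite ler_norml; apply/andP; split; lra.
    apply: le_trans (tree_mu_le _ _ y01) _; rewrite div1r exprVn.
    by rewrite lef_pV2 ?posrE ?exprn_gt0 ?ltr0n// -natrX ler_nat ltnW// ltn_expl.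
  rewrite -[leLHS]invrK lef_pV2 ?posrE ?invr_gt0 ?ltr0n// leNgt.
  by rewrite truncnS_gt.
pose j := ex_minn ex; exists j; last by rewrite /j; case: ex_minnP.
move=> i; rewrite /j; case: ex_minnP => m _ hm im.
by apply/eqP/negPn/negP => /hm; rewrite leqNgt im.
Qed.

Lemma tree_size y j : 0 <= y < 1 -> (j <= size (tree_w y j))%N.
Proof.
move=> y01; elim: j => //= j IH; rewrite size_cat -addn1 leq_add//.
exact: (lev_size j _ (tree_v_mem y j y01)).
Qed.

(** The strict bounds on [z j] let the Gauss map read the digits exactly; they hold because nonempty
    words still follow at every level. *)
Lemma tree_point y : 0 <= y < 1 -> exists x (z : nat -> R),
  forall j, [/\ 0 < z j < 1, x = cf (tree_w y j) (z j) & z j = cf (tree_v y j) (z j.+1)].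
Proof.
move=> y01.
have pv j : pos_word (tree_v y j) by apply: lev_pos; exact: tree_v_mem.
have [x hx] := @nested_cylinders R (tree_w y) (tree_v y) (fun j => tree_w_pos y j y01) pv
  (fun j => erefl).
have /choice[z hz] : forall j, exists z, 0 <= z <= 1 /\ x = cf (tree_w y j) z.
  by move=> j; have [z z01 xz] := hx j; exists z.
exists x, z.
have zE j : z j = cf (tree_v y j) (z j.+1).
  have [z01 xz] := hz j; have [z01' xz'] := hz j.+1.
  apply: (@cf_inj _ (tree_w y j)); rewrite ?tree_w_pos//; first exact: cf_bounds.
  by rewrite -cf_cat -xz xz'.
have z0 j : 0 < z j.
  rewrite zE cf_gt0//; first by have [] := hz j.+1.
  by rewrite -size_eq0 -lt0n; exact: (lev_size j _ (tree_v_mem y j y01)).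
have vN j : tree_v y j != [::].
  by rewrite -size_eq0 -lt0n; exact: (lev_size j _ (tree_v_mem y j y01)).
move=> j; have [z01 xz] := hz j; split => //; rewrite z0 /=.
rewrite zE; move: (pv j) (vN j); case: (tree_v y j) => [//|a v] /andP[a1 pv'] _ /=.
have a1R : 1 <= a%:R :> R by rewrite ler1n.
have c0 : 0 < cf v (z j.+1).
  case: v pv' => [_|b v pv']; first exact: z0.
  by apply: cf_gt0 => //; have [] := hz j.+1.
by rewrite invf_lt1; lra.
Qed.

End Tree.

(** * A Cantor subset of the larger set *)

(* [Block] appends a word of [words M N] followed by the separating digit 2;
   [Digit rho K] appends [rho] digits 2 and then one digit of [K, 2K). *)
Inductive kind := Block | Digit of nat & nat.

Section KindWords.
Context {R : realType} (M N : nat).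

Definition kind_words (k : kind) : seq (seq nat) :=
  match k with
  | Block => [seq u ++ [:: 2%N] | u <- words M N]
  | Digit rho K => [seq nseq rho 2%N ++ [:: (K + i)%N] | i <- iota 0 K]
  end.

Definition kind_ok (k : kind) : bool :=
  if k is Digit _ K then (1 < K)%N else true.

Implicit Types (k : kind) (w u v : seq nat) (x y z : R).

Lemma kind_words_pos k w : kind_ok k -> w \in kind_words k -> pos_word w.
Proof.
case: k => [_|rho K /= K1] /mapP[u hu ->]; rewrite pos_word_cat.
  by rewrite (words_pos _ _ _ hu).
by apply/andP; split; [rewrite /pos_word all_nseq orbT|rewrite /= andbT; lia].
Qed.

Lemma kind_words_size k w : w \in kind_words k -> (0 < size w)%N.
Proof. by case: k => [|rho K] /mapP[u hu ->]; rewrite size_cat addn1. Qed.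

Lemma kind_words_uniq k : uniq (kind_words k).
Proof.
case: k => [|rho K] /=; rewrite map_inj_uniq ?words_uniq ?iota_uniq//.
  by move=> u u'; rewrite !cats1 => /rcons_inj[].
by move=> i i' /eqP; rewrite eqseq_cat// eqxx /= => /eqP[]; lia.
Qed.

Lemma inv_addn4_itv : 0 < ((M + 4)%:R^-1 : R) <= 1 / 2.
Proof.
by rewrite invr_gt0 ltr0n addn_gt0 orbT /= div1r lef_pV2 ?posrE ?ltr0n ?ler_nat; lia.
Qed.

Let c0 : R := (M + 4)%:R^-1.

Let c0_itv : 0 < c0 <= 1 / 2 := inv_addn4_itv.

(* A partial quotient 1 is always followed by a bounded one. *)
Lemma cf_le_gap w z : pos_word w -> 0 <= z <= 1 -> w != [::] ->
  (forall v, w = 1%N :: v -> exists b v', v = b :: v' /\ (b <= M + 2)%N) ->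
  cf w z <= 1 - c0.
Proof.
case: w => [//|a w] pw z01 _ h; have /andP[c00 c02] := c0_itv.
have /andP[a1 pw'] := pw.
have /andP[cw0 _] := cf_bounds _ _ pw' z01.
have [a2|a2] := leqP 2 a.
  have a2R : 2 <= a%:R :> R by rewrite ler_nat.
  apply: (@le_trans _ _ (1 / 2)); last by lra.
  by rewrite /= div1r lef_pV2 ?posrE; lra.
have aE : a = 1%N by apply/eqP; rewrite eqn_leq a1 andbT -ltnS.
have [|b [v [wE bM]]] := h w; first by rewrite aE.
move: pw' cw0; rewrite aE wE => /andP[b1 pv] cw0.
have /andP[cv0 cv1] := cf_bounds _ _ pv z01.
have bR : b%:R <= M%:R + 2 :> R by rewrite -natrD ler_nat.
have b1R : 1 <= b%:R :> R by rewrite ler1n.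
have M0 : 0 <= M%:R :> R by [].
have hb : (M%:R + 3)^-1 <= (b%:R + cf v z)^-1 :> R by rewrite lef_pV2 ?posrE; lra.
have i0 : 0 < (M%:R + 3)^-1 :> R by rewrite invr_gt0; lra.
rewrite [cf _ _]/= /c0 natrD.
(* This bound equals $(M+3)/(M+4)$, whence the 4 in [c0]. *)
apply: (@le_trans _ _ (1 + (M%:R + 3)^-1)^-1); first by rewrite lef_pV2 ?posrE; lra.
rewrite le_eqVlt; apply/orP; left; apply/eqP; field.
by rewrite !lt0r_neq0//; lra.
Qed.

Lemma kind_words_gap k w z : kind_ok k -> w \in kind_words k -> 0 <= z <= 1 ->
  cf w z <= 1 - c0.
Proof.
move=> hk hw z01; apply: cf_le_gap => //; first exact: kind_words_pos hw.
  by rewrite -size_eq0 -lt0n; exact: kind_words_size hw.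
move=> v; case: k hk hw => [_|rho K /= K1] /mapP[u hu ->].
  case: u hu => [|a u] hu //= [_ <-].
  case: u hu => [|b u] hu; first by exists 2%N, [::]; split => //; exact: leq_addl.
  exists b, (u ++ [:: 2%N]); split => //.
  by move: hu; rewrite mem_words => /and3P[_ _ /= /andP[/andP[_ h] _]];
    exact: leq_trans h (leq_addr _ _).
by case: rho => [|rho] //= [] ; lia.
Qed.

Lemma natr_dist_ge1 (i j : nat) : i != j -> 1 <= `|i%:R - j%:R| :> R.
Proof.
case: (ltngtP i j) => // h _; rewrite ler_normr.
  have : i%:R + 1 <= j%:R :> R by rewrite natr1 ler_nat.
  by move=> ?; apply/orP; right; lra.
have : j%:R + 1 <= i%:R :> R by rewrite natr1 ler_nat.
by move=> ?; apply/orP; left; lra.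
Qed.

Lemma inv_dist_ge (p q P : R) : 0 < p <= P -> 0 < q <= P ->
  `|p - q| / P ^+ 2 <= `|p^-1 - q^-1|.
Proof.
move=> /andP[p0 pP] /andP[q0 qP]; have P0 : 0 < P by lra.
have -> : p^-1 - q^-1 = (q - p) / (p * q) by field; rewrite !gt_eqF.
rewrite normrM normfV (gtr0_norm (mulr_gt0 p0 q0)) distrC ler_wpM2l//.
rewrite lef_pV2 ?posrE ?exprn_gt0//; last exact: mulr_gt0.
by rewrite expr2 ler_pM// ltW.
Qed.

(** The tails take at most $1 - c_0$ from a distance that is at least 1. *)
Lemma nat_dist_ge (i i' : nat) (e e' : R) : i != i' -> 0 <= e <= 1 - c0 ->
  0 <= e' <= 1 - c0 -> c0 * `|i%:R - i'%:R| <= `|(i%:R + e) - (i'%:R + e')|.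
Proof.
have /andP[c00 c02] := c0_itv.
wlog ii' : i i' e e' / (i < i')%N.
  move=> H ne he he'; case: (ltngtP i i') => h; first exact: H.
    by rewrite distrC [leRHS]distrC; apply: H; rewrite // eq_sym.
  by rewrite h eqxx in ne.
move=> _ /andP[e0 e1] /andP[e'0 e'1].
have d : i%:R + 1 <= i'%:R :> R by rewrite natr1 ler_nat.
rewrite ltr0_norm; last lra; rewrite ltr0_norm; last lra.
have : c0 * (i'%:R - i%:R - 1) <= 1 * (i'%:R - i%:R - 1) by rewrite ler_wpM2r//; lra.
lra.
Qed.

(** At the first differing digit the gap below 1 keeps the tails [c0] apart; each common digit
    before it contracts distances by a factor of at most $(M+1)^2$. *)
Lemma block_separation n u u' z z' : u \in words M n -> u' \in words M n -> u != u' ->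
  0 <= z <= 1 -> 0 <= z' <= 1 ->
  c0 / (M.+1%:R ^+ 2) ^+ n <= `|cf (u ++ [:: 2%N]) z - cf (u' ++ [:: 2%N]) z'|.
Proof.
move=> + + + z01 z'01; have /andP[c00 c02] := c0_itv.
elim: n u u' => [|n IH] [|a u] [|a' u']; rewrite !mem_words //= !eqSS.
move=> /and3P[su /andP[a1 aM] hu] /and3P[su' /andP[a'1 a'M] hu'] ne.
have wu : u \in words M n by rewrite mem_words su.
have wu' : u' \in words M n by rewrite mem_words su'.
have pu : pos_word (u ++ [:: 2%N]) by rewrite pos_word_cat (words_pos _ _ _ wu).
have pu' : pos_word (u' ++ [:: 2%N]) by rewrite pos_word_cat (words_pos _ _ _ wu').
have gap v x : v \in words M n -> 0 <= x <= 1 -> 0 <= cf (v ++ [:: 2%N]) x <= 1 - c0.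
  move=> wv x01.
  have pv : pos_word (v ++ [:: 2%N]) by rewrite pos_word_cat (words_pos _ _ _ wv).
  have /andP[-> _] /= := cf_bounds _ _ pv x01.
  apply: cf_le_gap => //; first by rewrite -size_eq0 size_cat addn1.
  move=> r; case: v wv {pv} => [|b v] //= wv [_ <-].
  case: v wv => [|b' v] wv; first by exists 2%N, [::]; split => //; exact: leq_addl.
  exists b', (v ++ [:: 2%N]); split => //.
  by move: wv; rewrite mem_words => /and3P[_ _ /= /andP[/andP[_ h] _]];
    exact: leq_trans h (leq_addr _ _).
have /andP[e0 e1] := gap u z wu z01; have /andP[e'0 e'1] := gap u' z' wu' z'01.
set e := cf _ z in e0 e1 *; set e' := cf _ z' in e'0 e'1 *.
have aR : 1 <= (a%:R : R) <= M%:R by rewrite ler1n a1 ler_nat.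
have a'R : 1 <= (a'%:R : R) <= M%:R by rewrite ler1n a'1 ler_nat.
case/andP: aR => aR1 aR2; case/andP: a'R => a'R1 a'R2.
have P1 : 1 <= M.+1%:R ^+ 2 :> R by rewrite -natrX ler1n expn_gt0.
have P0 : 0 < M.+1%:R ^+ 2 :> R by lra.
have mS : M.+1%:R = M%:R + 1 :> R by rewrite natr1.
apply: le_trans (inv_dist_ge (a%:R + e) (a'%:R + e') M.+1%:R _ _); last 2 first.
- by rewrite mS; apply/andP; split; lra.
- by rewrite mS; apply/andP; split; lra.
rewrite exprSr invfM mulrA ler_wpM2r ?invr_ge0 ?(ltW P0)//.
have [aa|aa] := eqVneq a a'.
  rewrite aa opprD addrACA subrr add0r; apply: IH => //.
  by apply: contraNneq ne => ->; rewrite aa.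
apply: le_trans (nat_dist_ge a a' e e' aa _ _); rewrite ?e0 ?e'0//.
apply: (@le_trans _ _ c0).
  by rewrite ler_pdivrMr ?exprn_gt0// ler_peMr ?(ltW c00)// exprn_ege1.
rewrite ler_peMr ?(ltW c00)//.
exact: natr_dist_ge1.
Qed.

Context (s : R) (s_gt0 : 0 < s) (wsum_ge2 : 2 <= wsum M N s).

(** Blocks get the Gibbs weights $q^{-2s}$, normalised; [take N] removes the separating digit. Large
    digits are equidistributed. *)
Definition kind_weight (k : kind) (w : seq nat) : R :=
  match k with
  | Block => cfq (take N w) `^ (- (2 * s)) / wsum M N s
  | Digit _ K => K%:R^-1
  end.

Let wsum_pos : 0 < wsum M N s.
Proof. exact: lt_le_trans wsum_ge2. Qed.

Lemma kind_weight_gt0 k w : kind_ok k -> w \in kind_words k -> 0 < kind_weight k w.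
Proof.
case: k => [_|rho K K1] /mapP[u hu wE].
  rewrite wE /= take_size_cat ?(words_size _ _ _ hu)// divr_gt0// powR_gt0// cfq_gt0//.
  exact: words_pos hu.
by move: K1; rewrite /= invr_gt0 ltr0n; lia.
Qed.

Lemma kind_weight_le k w : kind_ok k -> w \in kind_words k -> kind_weight k w <= 1 / 2.
Proof.
case: k => [_|rho K K1] /mapP[u hu wE].
  rewrite wE /= take_size_cat ?(words_size _ _ _ hu)// ler_pdivrMr//.
  apply: (@le_trans _ _ 1); last by move: wsum_ge2; lra.
  have pu := words_pos _ _ _ hu; rewrite -[leRHS](powRr0 (cfq u)) ler_powR ?cfq_ge1//.
  by rewrite oppr_le0 mulr_ge0// ltW.
move: K1; rewrite /= => K1; rewrite div1r lef_pV2 ?posrE ?ltr0n ?ler_nat//; lia.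
Qed.

Lemma kind_weight_sum k : kind_ok k -> \sum_(w <- kind_words k) kind_weight k w = 1.
Proof.
case: k => [_|rho K /= K1] /=; rewrite big_map.
  rewrite big_seq.
  under eq_bigr => u hu do rewrite take_size_cat ?(words_size _ _ _ hu)//.
  by rewrite -big_seq -mulr_suml divff// gt_eqF.
rewrite big_const_seq count_predT size_iota iter_addr addr0 -[LHS]mulr_natl mulfV//.
by rewrite pnatr_eq0; lia.
Qed.

End KindWords.

(** * Hölder estimate for the coding map *)

Section CantorTree.
Context {R : realType} (M N : nat) (s : R) (s_gt0 : 0 < s) (s_le1 : s <= 1).
Context (wsum_ge2 : 2 <= wsum M N s).
Implicit Types (k : kind) (w u v : seq nat) (x y z : R).

Let c0 : R := (M + 4)%:R^-1.

Let c0_itv : 0 < c0 <= 1 / 2 := inv_addn4_itv M.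

Context (kd : nat -> kind) (kd_ok : forall j, kind_ok (kd j)).

Let lev j := kind_words M N (kd j).
Let wt j := kind_weight M N s (kd j).
Let tw := tree_w lev wt.
Let tmu := tree_mu lev wt.
Let ti := tree_i lev wt.
Let tv := tree_v lev wt.

(* The bounds on the mass of a cylinder that make the coding map Hölder. *)
Definition mass_bound (A : R) (k : kind) (w : seq nat) (m : R) : Prop :=
  match k with
  | Block => m * (cfq w ^+ 2) `^ s <= A
  | Digit rho K => m * (cfq (w ++ nseq rho 2%N) ^+ 2 * K%:R) `^ s <= A
  end.

Lemma cumul_digit rho K i : (i <= K)%N ->
  cumul (kind_words M N (Digit rho K)) (kind_weight M N s (Digit rho K)) i = i%:R / K%:R.
Proof.
move=> iK; rewrite /cumul /= -map_take big_map take_iota (minn_idPl iK).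
by rewrite big_const_seq count_predT size_iota iter_addr addr0 -[LHS]mulr_natl.
Qed.

(** Different blocks are separated by the constant [c] before [cf w] is applied, so the trivial
    bound $|t - t'| \le 1$ is enough. *)
Lemma holder_block (A mu t t' z z' : R) w v v' : 0 < A -> 0 < mu -> pos_word w ->
  0 <= t < 1 -> 0 <= t' < 1 -> 0 <= z <= 1 -> 0 <= z' <= 1 ->
  v \in kind_words M N Block -> v' \in kind_words M N Block -> v != v' ->
  mass_bound A Block w mu ->
  forall c : R, c = c0 / (M.+1%:R ^+ 2) ^+ N ->
  mu * `|t - t'| <= A * (4 / c) `^ s * `|cf w (cf v z) - cf w (cf v' z')| `^ s.
Proof.
move=> A0 mu0 pw /andP[t0 t1] /andP[t'0 t'1] z01 z'01 hv hv' vv' /= hm c cE.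
have pv := kind_words_pos M N Block v isT hv; have pv' := kind_words_pos M N Block v' isT hv'.
have /mapP[u hu vE] := hv; have /mapP[u' hu' v'E] := hv'.
have uu' : u != u' by apply: contraNneq vv' => uu; rewrite vE v'E uu.
have := block_separation M _ _ _ _ _ hu hu' uu' z01 z'01; rewrite -vE -v'E -cE => sep.
have c_gt0 : 0 < c by rewrite cE divr_gt0 ?exprn_gt0 ?ltr0n//; case/andP: c0_itv.
have q0 := cfq_gt0 (R := R) _ pw.
set d := `|cf w _ - _|.
have hd : 1 <= cfq w ^+ 2 * (4 / c * d).
  have := cf_dist_ge _ _ _ pw (cf_bounds _ _ pv z01) (cf_bounds _ _ pv' z'01).
  rewrite -/d => h; have := le_trans (ler_wpM2r _ sep) h.
  rewrite invr_ge0 mulr_ge0 ?sqr_ge0// => /(_ isT).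
  rewrite ler_pdivrMr ?mulr_gt0 ?exprn_gt0// => h'.
  have -> : cfq w ^+ 2 * (4 / c * d) = d * (4 * cfq w ^+ 2) / c by field; rewrite gt_eqF.
  by rewrite ler_pdivlMr// mul1r.
have hds : 1 <= (cfq w ^+ 2) `^ s * ((4 / c) `^ s * d `^ s).
  have c4 : 0 <= 4 / c by rewrite divr_ge0// ltW.
  have cd : 0 <= 4 / c * d by exact: mulr_ge0 c4 (normr_ge0 _).
  rewrite -(powRM _ c4 (normr_ge0 _)) -(powRM _ (sqr_ge0 _) cd).
  apply: (@le_trans _ _ (1 `^ s)); first by rewrite powR1.
  by apply: ge0_ler_powR; rewrite ?nnegrE ?(ltW s_gt0) ?(mulr_ge0 (sqr_ge0 _) cd).
apply: (@le_trans _ _ (mu * 1)).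
  by rewrite ler_wpM2l ?(ltW mu0)// ler_norml; apply/andP; split; lra.
apply: le_trans (ler_wpM2l (ltW mu0) hds) _.
by rewrite [leLHS]mulrA -[leRHS]mulrA ler_wpM2r// mulr_ge0 ?powR_ge0.
Qed.

(** Here [K] is unbounded, so the distance $D$ of the two digits must be kept: they differ by about
    $D/K$ in relative mass and $D/K^2$ in position. As $D \le K$ and $s \le 1$, $D/K \le (D/K)^s$.
    The constant 16 is 4 from the distortion of [cf W] times 4 from [x <= 2K]. *)
Lemma holder_digit (A mu z z' t t' : R) w rho K (i i' : nat) :
  0 < A -> 0 < mu -> pos_word w ->
  (i < K)%N -> (i' < K)%N -> i != i' ->
  0 <= t < 1 -> 0 <= t' < 1 -> 0 <= z <= 1 - c0 -> 0 <= z' <= 1 - c0 ->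
  mass_bound A (Digit rho K) w mu ->
  mu * `|(i%:R + t) / K%:R - (i'%:R + t') / K%:R| <= 2 * A * (16 / c0) `^ s *
    `|cf w (cf (nseq rho 2%N ++ [:: (K + i)%N]) z) -
      cf w (cf (nseq rho 2%N ++ [:: (K + i')%N]) z')| `^ s.
Proof.
move=> A0 mu0 pw iK i'K ii' /andP[t0 t1] /andP[t'0 t'1] hz hz' /= hm.
have /andP[c00 c02] := c0_itv.
have /andP[z0 z1] := hz; have /andP[z'0 z'1] := hz'.
have K0 : 0 < K%:R :> R by rewrite ltr0n; exact: leq_ltn_trans iK.
set W := w ++ nseq rho 2%N in hm *.
have cfW a (x : R) : cf w (cf (nseq rho 2%N ++ [:: a]) x) = cf W (a%:R + x)^-1.
  by rewrite -cf_cat catA cf_cat.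
have pW : pos_word W by rewrite pos_word_cat pw /= /pos_word all_nseq orbT.
have q0 := cfq_gt0 (R := R) _ pW.
set D := `|i%:R - i'%:R| : R.
have D1 : 1 <= D by exact: natr_dist_ge1.
have iKR : i%:R + 1 <= K%:R :> R by rewrite natr1 ler_nat.
have i'KR : i'%:R + 1 <= K%:R :> R by rewrite natr1 ler_nat.
have i0 : 0 <= i%:R :> R by [].
have i'0 : 0 <= i'%:R :> R by [].
have DK : D <= K%:R by rewrite ler_norml; apply/andP; split; lra.
rewrite !cfW !natrD.
set x := K%:R + i%:R + z; set x' := K%:R + i'%:R + z'.
set d := `|cf W _ - _|.
have x01 : 0 <= x^-1 <= 1.
  have x1 : 1 <= x by rewrite /x; lra.
  by rewrite invr_ge0 invf_le1; lra.
have x'01 : 0 <= x'^-1 <= 1.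
  have x1 : 1 <= x' by rewrite /x'; lra.
  by rewrite invr_ge0 invf_le1; lra.
have sep : c0 * D / (2 * K%:R) ^+ 2 <= `|x^-1 - x'^-1|.
  apply: le_trans (inv_dist_ge x x' (2 * K%:R) _ _); last 2 first.
  - by rewrite /x; apply/andP; split; lra.
  - by rewrite /x'; apply/andP; split; lra.
  rewrite ler_wpM2r ?invr_ge0 ?sqr_ge0//.
  have -> : x - x' = (i%:R + z) - (i'%:R + z') by rewrite /x /x'; ring.
  exact: (nat_dist_ge M).
have hd : D / K%:R <= (cfq W ^+ 2 * K%:R) * (16 / c0 * d).
  have := cf_dist_ge _ _ _ pW x01 x'01; rewrite -/d => h.
  have := le_trans (ler_wpM2r _ sep) h.
  rewrite invr_ge0 mulr_ge0 ?sqr_ge0// => /(_ isT).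
  rewrite ler_pdivrMr ?mulr_gt0 ?exprn_gt0// ler_pdivrMr ?exprn_gt0 ?mulr_gt0// => h'.
  rewrite ler_pdivrMr//.
  have -> : cfq W ^+ 2 * K%:R * (16 / c0 * d) * K%:R =
    (d * (4 * cfq W ^+ 2) * (2 * K%:R) ^+ 2) / c0 by field; rewrite gt_eqF.
  by rewrite ler_pdivlMr// mulrC.
have q2K : 0 <= cfq W ^+ 2 * K%:R :> R by rewrite mulr_ge0 ?sqr_ge0.
have r0 : 0 <= 16 / c0 by rewrite divr_ge0 ?(ltW c00).
have hds : D / K%:R <= (cfq W ^+ 2 * K%:R) `^ s * ((16 / c0) `^ s * d `^ s).
  have cd : 0 <= 16 / c0 * d by exact: mulr_ge0 r0 (normr_ge0 _).
  rewrite -(powRM _ r0 (normr_ge0 _)) -(powRM _ q2K cd).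
  apply: (@le_trans _ _ ((D / K%:R) `^ s)).
    by apply: ger1_powR => //; rewrite divr_gt0 ?ler_pdivrMr ?mul1r//; lra.
  apply: ge0_ler_powR; rewrite ?nnegrE ?(ltW s_gt0) ?(mulr_ge0 q2K cd)//.
  by rewrite divr_ge0 ?(ltW K0)//; lra.
apply: (@le_trans _ _ (mu * (2 * (D / K%:R)))).
  rewrite ler_wpM2l ?(ltW mu0)// -mulrBl normrM normfV (gtr0_norm K0) mulrA.
  rewrite ler_wpM2r ?invr_ge0 ?(ltW K0)//.
  have -> : i%:R + t - (i'%:R + t') = (i%:R - i'%:R) + (t - t') by ring.
  apply: le_trans (ler_normD _ _) _; rewrite -/D.
  have : `|t - t'| <= 1 by rewrite ler_norml; apply/andP; split; lra.
  lra.
rewrite mulrCA -[2 * A * _]mulrA -[2 * (A * _) * _]mulrA ler_wpM2l//.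
apply: le_trans (ler_wpM2l (ltW mu0) hds) _.
by rewrite [leLHS]mulrA -[leRHS]mulrA ler_wpM2r// mulr_ge0 ?powR_ge0.
Qed.

(** Up to the first level where the codes of [y] and [y'] differ, both points share a cylinder, and
    at that level one of the two preceding estimates applies. The gap required of the tails comes
    from the words read one level later. *)
Lemma hausdorff_dim_ge_tree (A : R) (E : set R) : 0 < A ->
  (forall y j, 0 <= y < 1 -> mass_bound A (kd j) (tw y j) (tmu y j)) ->
  (forall y x (z : nat -> R), 0 <= y < 1 ->
    (forall j, [/\ 0 < z j < 1, x = cf (tw y j) (z j) & z j = cf (tv y j) (z j.+1)]) -> E x) ->
  (s%:E <= hausdorff_dim E)%E.
Proof.
move=> A0 hmass hE.
have wt0 j w : w \in lev j -> 0 < wt j w by exact: kind_weight_gt0.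
have wt2 j w : w \in lev j -> wt j w <= 1 / 2 by exact: kind_weight_le.
have wts j : \sum_(w <- lev j) wt j w = 1 by exact: kind_weight_sum.
have lpos j w : w \in lev j -> pos_word w by exact: kind_words_pos.
have lsize j w : w \in lev j -> (0 < size w)%N by exact: kind_words_size.
have /choice[f hf] : forall y, exists x, 0 <= y < 1 -> exists z : nat -> R,
  forall j, [/\ 0 < z j < 1, x = cf (tw y j) (z j) & z j = cf (tv y j) (z j.+1)].
  move=> y; have [y01|] := boolP (0 <= y < 1); last by exists 0.
  have [x [z hz]] := tree_point lev wt wt0 wts lpos lsize y y01.
  by exists x => _; exists z.
pose c := c0 / (M.+1%:R ^+ 2) ^+ N.
have c00 : 0 < c0 by case/andP: c0_itv.
have c_gt0 : 0 < c by rewrite divr_gt0 ?exprn_gt0 ?ltr0n.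
pose C1 := A * (4 / c) `^ s; pose C2 := 2 * A * (16 / c0) `^ s.
have C10 : 0 < C1 by rewrite mulr_gt0 ?powR_gt0 ?divr_gt0.
have C20 : 0 < C2 by rewrite !mulr_gt0 ?powR_gt0 ?divr_gt0.
apply: (hausdorff_dim_ge s (C1 + C2) E f) => //; first exact: addr_gt0.
  by move=> y y01; have [z hz] := hf y y01; exact: hE y01 hz.
move=> y y' y01 y'01.
have [->|yy'] := eqVneq y y'.
  by rewrite subrr normr0 mulr_ge0 ?powR_ge0// ltW// addr_gt0.
have [j agr dif] := tree_split lev wt wt0 wt2 wts y y' y01 y'01 yy'.
have [hw hmu hy] := tree_agree lev wt wt0 wts y y' j y01 y'01 agr.
have [z hz] := hf y y01; have [z' hz'] := hf y' y'01.
have [/andP[zj0 zj1] xE zE] := hz j; have [/andP[zj0' zj1'] xE' zE'] := hz' j.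
have mu0 := tree_mu_gt0 lev wt wt0 wts y j y01.
rewrite hy normrM (gtr0_norm mu0).
have pw := tree_w_pos lev wt wt0 wts lpos y j y01.
have ty := tree_t_itv lev wt wt0 wts y j y01.
have ty' := tree_t_itv lev wt wt0 wts y' j y'01.
have tyS := tree_t_itv lev wt wt0 wts y j.+1 y01.
have tyS' := tree_t_itv lev wt wt0 wts y' j.+1 y'01.
have vm := tree_v_mem lev wt wt0 wts y j y01.
have vm' := tree_v_mem lev wt wt0 wts y' j y'01.
have il := tree_i_lt lev wt wt0 wts y j y01.
have il' := tree_i_lt lev wt wt0 wts y' j y'01.
have hm := hmass y j y01.
have [/andP[zS0 zS1] _ zSE] := hz j.+1; have [/andP[zS0' zS1'] _ zSE'] := hz' j.+1.
have zSb : 0 <= z j.+1 <= 1 by rewrite !ltW.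
have zSb' : 0 <= z' j.+1 <= 1 by rewrite !ltW.
have gz : 0 <= z j.+1 <= 1 - c0.
  rewrite (ltW zS0) zSE; apply: (kind_words_gap M N (kd j.+1)) => //.
    exact: (tree_v_mem lev wt wt0 wts y j.+1 y01).
  by have [/andP[? ?] _ _] := hz j.+2; rewrite !ltW.
have gz' : 0 <= z' j.+1 <= 1 - c0.
  rewrite (ltW zS0') zSE'; apply: (kind_words_gap M N (kd j.+1)) => //.
    exact: (tree_v_mem lev wt wt0 wts y' j.+1 y'01).
  by have [/andP[? ?] _ _] := hz' j.+2; rewrite !ltW.
set d := `|f y - f y'| `^ s.
have d0 : 0 <= d by exact: powR_ge0.
suff : tree_mu lev wt y j * `|tree_t lev wt y j - tree_t lev wt y' j| <= C1 * d \/
       tree_mu lev wt y j * `|tree_t lev wt y j - tree_t lev wt y' j| <= C2 * d.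
  have := mulr_ge0 (ltW C10) d0; have := mulr_ge0 (ltW C20) d0; rewrite mulrDl.
  by move=> ? ? []; lra.
have dE : d = `|cf (tw y j) (cf (tv y j) (z j.+1)) -
                cf (tw y j) (cf (tv y' j) (z' j.+1))| `^ s.
  by rewrite /d xE xE' zE zE' /tw hw.
have tE := tree_tE lev wt wt0 wts y j y01; have tE' := tree_tE lev wt wt0 wts y' j y'01.
have vE : tv y j = nth [::] (lev j) (ti y j) by [].
have vE' : tv y' j = nth [::] (lev j) (ti y' j) by [].
have kE := kd_ok j; rewrite {}dE.
move: hm kE vm vm' il il' tE tE' vE vE' dif.
rewrite -/(ti y j) -/(ti y' j) -/(tv y j) -/(tv y' j) -/(tmu y j) /lev /wt -/lev -/wt.
case: (kd j) => [|rho K] hm kE vm vm' il il' tE tE' vE vE' dif.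
  left; apply: (holder_block A) => //.
  by rewrite vE vE' nth_uniq// kind_words_uniq.
right; move: il il'; rewrite size_map size_iota => il il'.
rewrite tE tE' vE vE' !cumul_digit ?(ltnW il) ?(ltnW il')//=.
rewrite !(nth_map 0%N) ?size_iota// !nth_iota// !add0n.
rewrite ![_^-1 * _]mulrC -!mulrDl.
by apply: holder_digit => //; rewrite ?tyS.
Qed.

End CantorTree.

(** * Long runs of blocks alternating with pairs of large digits *)

Section LowerBound.
Context {R : realType} (M N : nat) (s b2 b3 : R) (nxt : nat -> nat).
Context (s_gt0 : 0 < s) (s_lt1 : s < 1) (b2_gt0 : 0 < b2) (b3_gt0 : 0 < b3).
Context (wsum_big : 64 * expR (N.+1%:R * (b3 * lower_exponent s)) < wsum M N s).
Context (nxt_gt : forall st, (st < nxt st)%N).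
(* Sparseness: the gain of the blocks over the rate [b2] absorbs all constants. *)
Context (nxt_sparse : forall st, 2048 * 16 ^+ N.+1 *
  expR (- ((b3 * lower_exponent s) * ((nxt st)%:R - 1 - st%:R - N.+1%:R))) *
  expR ((nxt st)%:R * (b2 * lower_exponent s)) <= 1).

Let c := b3 * lower_exponent s.
(** With $X = e^{n b_2 \alpha}$ and $Y = e^{n b_2 (1 - 2\alpha)}$ one has $X^2 Y = e^{n b_2}$.
    Passing from $X$ to $Y$ multiplies the mass bound by $Y^s X^{s-1}$ up to constants, and this is
    1 exactly when $\alpha(1+s) = s$. *)
Let al := s / (1 + s).

Let al_gt0 : 0 < al. Proof. by rewrite divr_gt0// addr_gt0. Qed.
Let al_lt : 2 * al < 1.
Proof.
have h : 0 < 1 + s by exact: addr_gt0.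
by rewrite /al mulrA ltr_pdivrMr// mul1r; move: s_lt1; lra.
Qed.
Let alE : al * s = lower_exponent s.
Proof. by rewrite /al /lower_exponent mulrAC expr2. Qed.
Let alE2 : al * (1 + s) = s.
Proof. by rewrite /al divfK// gt_eqF// addr_gt0. Qed.
Let c_gt0 : 0 < c.
Proof. by apply: mulr_gt0 => //; exact: lower_exponent_gt0. Qed.

(** There are [(nxt st).-1 - st] places before position [nxt st]; blocks take [N.+1] each, and
    digits 2 fill the rest. *)
Let stage_m st := (((nxt st).-1 - st) %/ N.+1)%N.
Let stage_r st := (((nxt st).-1 - st) %% N.+1)%N.
Let dX st := (Num.truncn (expR ((nxt st)%:R * (b2 * al)))).+1.
Let dY st := (Num.truncn (expR ((nxt st)%:R * (b2 * (1 - 2 * al))))).+1.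

(* A state [(st, i)] means that a stage begins after [st] digits and that [i]
   of its levels are done: [stage_m st] blocks, then the two large digits at
   positions [nxt st] and [(nxt st).+1]. *)
Let next (p : nat * nat) : nat * nat :=
  if (p.2 <= stage_m p.1)%N then (p.1, p.2.+1) else ((nxt p.1).+1, 0%N).
Let state j := iter j next (0%N, 0%N).
Let kind_of (p : nat * nat) : kind :=
  if (p.2 < stage_m p.1)%N then Block
  else if p.2 == stage_m p.1 then Digit (stage_r p.1) (dX p.1)
  else Digit 0 (dY p.1).
Let kd j := kind_of (state j).

Let stage_len st : (st + stage_m st * N.+1 + stage_r st).+1 = nxt st.
Proof.
have := nxt_gt st; rewrite /stage_m /stage_r -addnA -divn_eq.
by case: (nxt st) => // n h; rewrite subnKC.
Qed.

Let truncn_expR_ge1 (x : R) : 0 <= x -> (0 < Num.truncn (expR x))%N.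
Proof. by move=> x0; rewrite truncn_gt0 -expR0 ler_expR. Qed.

Let dX_bounds st : expR ((nxt st)%:R * (b2 * al)) <= (dX st)%:R <=
  2 * expR ((nxt st)%:R * (b2 * al)) /\ (1 < dX st)%N.
Proof.
have h : 0 <= (nxt st)%:R * (b2 * al).
  by apply: mulr_ge0 => //; exact: mulr_ge0 (ltW b2_gt0) (ltW al_gt0).
have h1 : 1 <= expR ((nxt st)%:R * (b2 * al)) by rewrite -[leLHS]expR0 ler_expR.
split; last by rewrite ltnS truncn_expR_ge1.
rewrite ltW ?truncnS_gt//= /dX -natr1.
have : (Num.truncn (expR ((nxt st)%:R * (b2 * al))))%:R <= expR ((nxt st)%:R * (b2 * al)).
  by rewrite truncn_le expR_ge0.
lra.
Qed.

Let dY_bounds st : expR ((nxt st)%:R * (b2 * (1 - 2 * al))) <= (dY st)%:R <=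
  2 * expR ((nxt st)%:R * (b2 * (1 - 2 * al))) /\ (1 < dY st)%N.
Proof.
have h : 0 <= (nxt st)%:R * (b2 * (1 - 2 * al)).
  apply: mulr_ge0 => //; apply: mulr_ge0; first exact: ltW.
  by rewrite subr_ge0 ltW.
have h1 : 1 <= expR ((nxt st)%:R * (b2 * (1 - 2 * al))) by rewrite -[leLHS]expR0 ler_expR.
split; last by rewrite ltnS truncn_expR_ge1.
rewrite ltW ?truncnS_gt//= /dY -natr1.
have : (Num.truncn (expR ((nxt st)%:R * (b2 * (1 - 2 * al)))))%:R <=
  expR ((nxt st)%:R * (b2 * (1 - 2 * al))).
  by rewrite truncn_le expR_ge0.
lra.
Qed.

Let kd_ok j : kind_ok (kd j).
Proof.
rewrite /kd /kind_of; case: ifP => // _; case: ifP => _ /=.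
  by have [] := dX_bounds (state j).1.
by have [] := dY_bounds (state j).1.
Qed.

Let wsum_ge2 : 2 <= wsum M N s.
Proof.
have : 0 <= N.+1%:R * c by rewrite mulr_ge0// ltW.
have := expR_ge1Dx (N.+1%:R * c); move: wsum_big; rewrite -/c; lra.
Qed.

Let powR_const_le (k x : R) : 1 <= k -> 0 <= x -> (k * x) `^ s <= k * x `^ s.
Proof.
move=> k1 x0; have k0 : 0 <= k by lra.
by rewrite powRM// ler_wpM2r ?powR_ge0//; apply: ler1_powR => //; exact: ltW.
Qed.

Let powR_mono (x y : R) : 0 <= x -> x <= y -> x `^ s <= y `^ s.
Proof.
move=> x0 xy; apply: ge0_ler_powR; rewrite ?nnegrE//; first exact: ltW.
exact: le_trans xy.
Qed.

Let cfq_nseq2 w rho : pos_word w -> cfq (w ++ nseq rho 2%N) <= 4 ^+ rho * cfq w :> R.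
Proof.
move=> pw; elim: rho => [|r IH]; first by rewrite cats0 expr0 mul1r.
have pr : pos_word (w ++ nseq r 2%N) by rewrite pos_word_cat pw /= /pos_word all_nseq orbT.
rewrite -(addn1 r) nseqD catA; apply: le_trans (cfq_cat_le _ _ pr _) _ => //.
rewrite cfq1 exprD expr1; have := IH; lra.
Qed.

(** Two concatenations and the digit 2 cost a factor $2 \cdot 2 \cdot 2 = 8$ in the continuant,
    hence 64 in its square. The weight cancels the power of [cfq u] and leaves [64 / wsum M N s],
    which [wsum_big] controls. *)
Let block_step (mu e : R) w v : 0 <= mu -> pos_word w -> v \in kind_words M N Block ->
  mu * (cfq w ^+ 2) `^ s <= e ->
  mu * kind_weight M N s Block v * (cfq (w ++ v) ^+ 2) `^ s <= e * expR (- (N.+1%:R * c)).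
Proof.
move=> mu0 pw /mapP[u hu ->] h.
have pu := words_pos _ _ _ hu; have qu := cfq_gt0 (R := R) _ pu.
have qw := cfq_gt0 (R := R) _ pw.
have pv : pos_word (u ++ [:: 2%N]) by rewrite pos_word_cat pu.
rewrite /= take_size_cat ?(words_size _ _ _ hu)//.
have q1 : cfq (w ++ u ++ [:: 2%N]) <= 8 * (cfq w * cfq u) :> R.
  apply: le_trans (cfq_cat_le _ _ pw pv) _.
  have := cfq_cat_le (R := R) _ _ pu (isT : pos_word [:: 2%N]); rewrite cfq1 => h'.
  have := ler_wpM2l (ltW qw) h'; lra.
have q10 : 0 <= cfq (w ++ u ++ [:: 2%N]) :> R.
  by rewrite ltW// cfq_gt0// pos_word_cat pw.
have q2 : (cfq (w ++ u ++ [:: 2%N]) ^+ 2) `^ s <= 64 * ((cfq w ^+ 2) `^ s * (cfq u ^+ 2) `^ s).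
  rewrite -powRM ?sqr_ge0//; have k1 : 1 <= 64 :> R by rewrite ler1n.
  apply: le_trans (powR_const_le _ _ k1 _); last by rewrite mulr_ge0 ?sqr_ge0.
  apply: powR_mono; first exact: sqr_ge0.
  have -> : 64 * (cfq w ^+ 2 * cfq u ^+ 2) = (8 * (cfq w * cfq u)) ^+ 2 :> R by ring.
  by rewrite lerXn2r// nnegrE mulr_ge0// mulr_ge0// ltW.
have W0 : 0 < wsum M N s by exact: lt_le_trans wsum_ge2.
have uE : cfq u `^ (- (2 * s)) * (cfq u ^+ 2) `^ s = 1 :> R.
  rewrite -powR_mulrn ?(ltW qu)// -powRrM -powRD; last by rewrite (gt_eqF qu) implybT.
  by rewrite addNr powRr0.
have F1 : 64 / wsum M N s <= expR (- (N.+1%:R * c)).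
  rewrite expRN ler_pdivrMr// mulrC ler_pdivlMr ?expR_gt0//.
  exact: ltW wsum_big.
apply: le_trans (ler_wpM2l _ q2) _.
  exact: mulr_ge0 mu0 (divr_ge0 (powR_ge0 _ _) (ltW W0)).
have -> : mu * (cfq u `^ (- (2 * s)) / wsum M N s) *
    (64 * ((cfq w ^+ 2) `^ s * (cfq u ^+ 2) `^ s)) =
    (mu * (cfq w ^+ 2) `^ s) * (64 / wsum M N s) *
    (cfq u `^ (- (2 * s)) * (cfq u ^+ 2) `^ s).
  by field; rewrite gt_eqF.
rewrite uE mulr1; apply: ler_pM => //; first by rewrite mulr_ge0 ?powR_ge0.
by rewrite divr_ge0 ?(ltW W0).
Qed.

(* The loss [16 K^s] of passing to the larger continuant is compared with the
   factor [K^-1] of the mass. *)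
Let digit_step (mu e k : R) w rho K v : 0 <= mu -> 1 <= k -> (0 < K)%N -> pos_word w ->
  v \in kind_words M N (Digit rho K) ->
  mu * (cfq (w ++ nseq rho 2%N) ^+ 2 * K%:R) `^ s <= e ->
  mu * kind_weight M N s (Digit rho K) v * (cfq (w ++ v) ^+ 2 * k) `^ s <=
    16 * e * (k `^ s * K%:R `^ (s - 1)).
Proof.
move=> mu0 k1 K0 pw /mapP[i hi ->] h.
have KR : 0 < K%:R :> R by rewrite ltr0n.
have k0 : 0 < k by lra.
rewrite catA; set W := w ++ nseq rho 2%N in h *.
have pW : pos_word W by rewrite pos_word_cat pw /= /pos_word all_nseq orbT.
have qW := cfq_gt0 (R := R) _ pW.
have pa : pos_word [:: (K + i)%N] by rewrite /pos_word /= andbT addn_gt0 K0.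
have q1 : cfq (W ++ [:: (K + i)%N]) <= 4 * (cfq W * K%:R) :> R.
  apply: le_trans (cfq_cat_le _ _ pW pa) _; rewrite cfq1 natrD.
  have : i%:R <= K%:R :> R by move: hi; rewrite mem_iota ler_nat => /andP[_ /ltnW].
  move=> iK; have : cfq W * i%:R <= cfq W * K%:R :> R by rewrite ler_wpM2l// ltW.
  lra.
have q10 : 0 <= cfq (W ++ [:: (K + i)%N]) :> R.
  by rewrite ltW// cfq_gt0// pos_word_cat pW.
have q2 : (cfq (W ++ [:: (K + i)%N]) ^+ 2 * k) `^ s <=
    16 * ((cfq W ^+ 2 * K%:R) `^ s * (K%:R `^ s * k `^ s)).
  have A1 : 0 <= cfq W ^+ 2 * K%:R :> R by exact: mulr_ge0 (sqr_ge0 _) (ltW KR).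
  have A2 : 0 <= K%:R * k by exact: mulr_ge0 (ltW KR) (ltW k0).
  rewrite -(powRM _ (ltW KR) (ltW k0)) -(powRM _ A1 A2).
  have l1 : 1 <= 16 :> R by rewrite ler1n.
  apply: le_trans (powR_const_le _ _ l1 (mulr_ge0 A1 A2)).
  apply: powR_mono; first exact: mulr_ge0 (sqr_ge0 _) (ltW k0).
  have -> : 16 * (cfq W ^+ 2 * K%:R * (K%:R * k)) =
    (4 * (cfq W * K%:R)) ^+ 2 * k :> R by ring.
  rewrite ler_wpM2r ?(ltW k0)// lerXn2r// nnegrE mulr_ge0// mulr_ge0// ltW//.
apply: le_trans (ler_wpM2l _ q2) _; first by rewrite /= mulr_ge0// invr_ge0 ltW.
have KE : K%:R `^ (s - 1) = K%:R `^ s / K%:R :> R.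
  by rewrite powRB ?(gt_eqF KR) ?implybT// powRr1// ltW.
rewrite KE /=.
have -> : mu / K%:R * (16 * ((cfq W ^+ 2 * K%:R) `^ s * (K%:R `^ s * k `^ s))) =
  16 * (mu * (cfq W ^+ 2 * K%:R) `^ s) * (k `^ s * (K%:R `^ s / K%:R)) by ring.
apply: ler_wpM2r; last exact: ler_wpM2l.
exact: mulr_ge0 (powR_ge0 _ _) (divr_ge0 (powR_ge0 _ _) (ltW KR)).
Qed.

(** The blocks have lowered the mass bound at rate [c] per digit, and sparseness makes this outweigh
    $X^s$. Each filler costs 4 in the continuant, at most [16 ^+ N.+1] in the square, and rounding
    [dX] costs 2, whence $2048 = 2 \cdot 1024$. *)
Let X_mass st (mu : R) w : 0 <= mu -> pos_word w ->
  mu * (cfq w ^+ 2) `^ s <= 1024 * expR (- ((stage_m st * N.+1)%:R * c)) ->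
  mu * (cfq (w ++ nseq (stage_r st) 2%N) ^+ 2 * (dX st)%:R) `^ s <= 1.
Proof.
move=> mu0 pw h; have qw := cfq_gt0 (R := R) _ pw.
set r := stage_r st; have rN : (r < N.+1)%N by rewrite ltn_mod.
have [/andP[_ hX] _] := dX_bounds st; set E := expR _ in hX.
have E0 : 0 < E by exact: expR_gt0.
have pr : pos_word (w ++ nseq r 2%N) by rewrite pos_word_cat pw /= /pos_word all_nseq orbT.
have q0 := cfq_gt0 (R := R) _ pr.
have q1 : (cfq (w ++ nseq r 2%N) ^+ 2 * (dX st)%:R) `^ s <=
    16 ^+ N.+1 * 2 * ((cfq w ^+ 2) `^ s * E `^ s).
  rewrite -powRM ?sqr_ge0 ?(ltW E0)//.
  have k1 : 1 <= 16 ^+ N.+1 * 2 :> R.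
    by have : 1 <= 16 ^+ N.+1 :> R; [by rewrite exprn_ege1// ler1n|lra].
  apply: le_trans (powR_const_le _ _ k1 _); last by rewrite mulr_ge0 ?sqr_ge0 ?(ltW E0).
  apply: powR_mono; first by rewrite mulr_ge0 ?sqr_ge0.
  have -> : 16 ^+ N.+1 * 2 * (cfq w ^+ 2 * E) = (4 ^+ N.+1 * cfq w) ^+ 2 * (2 * E) :> R.
    have -> : 16 ^+ N.+1 = (4 ^+ N.+1) ^+ 2 :> R.
      by rewrite -exprM mulnC exprM; congr (_ ^+ _); ring.
    by ring.
  apply: ler_pM => //; first exact: sqr_ge0.
  rewrite lerXn2r ?nnegrE ?(ltW q0)//; first by rewrite mulr_ge0 ?exprn_ge0 ?(ltW qw).
  apply: le_trans (cfq_nseq2 _ _ pw) _; rewrite ler_wpM2r ?(ltW qw)//.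
  by apply: ler_weXn2l; [rewrite ler1n|exact: ltnW].
apply: le_trans (ler_wpM2l mu0 q1) _.
have -> : mu * (16 ^+ N.+1 * 2 * ((cfq w ^+ 2) `^ s * E `^ s)) =
  (mu * (cfq w ^+ 2) `^ s) * (2 * 16 ^+ N.+1 * E `^ s) by ring.
apply: le_trans (ler_wpM2r _ h) _.
  by rewrite !mulr_ge0 ?powR_ge0 ?exprn_ge0.
apply: le_trans (nxt_sparse st).
have -> : E `^ s = expR ((nxt st)%:R * (b2 * lower_exponent s)).
  by rewrite /E -expRM -alE; congr expR; ring.
have E1 (e1 e2 p : R) : 1024 * e1 * (2 * p * e2) = 2048 * p * e1 * e2 by ring.
rewrite E1; apply: ler_wpM2r; first exact: expR_ge0.
apply: ler_wpM2l; first exact: mulr_ge0 (ler0n _ _) (exprn_ge0 _ (ler0n _ _)).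
rewrite ler_expR lerN2 -/c mulrC ler_wpM2r ?(ltW c_gt0)//.
have /(congr1 (fun n : nat => n%:R : R)) := stage_len st.
rewrite -natr1 !natrD -/r => <-.
have : r%:R <= N.+1%:R :> R by rewrite ler_nat ltnW.
lra.
Qed.

Let lev j := kind_words M N (kd j).
Let wt j := kind_weight M N s (kd j).
Let tw := tree_w lev wt.
Let tmu := tree_mu lev wt.

(** Constants do not build up: [X_mass] resets the bound to 1 before the first large digit, which
    raises it to at most $16 \cdot 2 \le 64$; the second raises it to $16 \cdot 64 = 1024$, the
    value at the start of a stage. *)
Let invariant (p : nat * nat) (w : seq nat) (mu : R) : Prop :=
  [/\ (p.2 <= (stage_m p.1).+1)%N,
      size w = (if p.2 <= stage_m p.1 then p.1 + p.2 * N.+1 else nxt p.1)%N &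
      if (p.2 <= stage_m p.1)%N
      then mu * (cfq w ^+ 2) `^ s <= 1024 * expR (- ((p.2 * N.+1)%:R * c))
      else mu * (cfq w ^+ 2 * (dY p.1)%:R) `^ s <= 64].

Let wt0 j w : w \in lev j -> 0 < wt j w.
Proof. exact: kind_weight_gt0. Qed.
Let wts j : \sum_(w <- lev j) wt j w = 1.
Proof. exact: kind_weight_sum. Qed.
Let lpos j w : w \in lev j -> pos_word w.
Proof. exact: kind_words_pos. Qed.
Let lsize j w : w \in lev j -> (0 < size w)%N.
Proof. exact: kind_words_size. Qed.

Let invariant_step p w v mu : 0 <= mu -> pos_word w ->
  v \in kind_words M N (kind_of p) -> invariant p w mu ->
  invariant (next p) (w ++ v) (mu * kind_weight M N s (kind_of p) v).
Proof.
have s1 := s_lt1; case: p => st i mu0 pw; rewrite /invariant /next /kind_of /=.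
have [/andP[X1 X2] X3] := dX_bounds st; have [/andP[Y1 Y2] Y3] := dY_bounds st.
have YR : 1 <= (dY st)%:R :> R by rewrite ler1n ltnW.
case: ltngtP => im hv [hi hs hm] /=.
- rewrite im ltnS (ltnW im); split => //.
    by move/mapP: hv => [u hu ->]; rewrite !size_cat hs (words_size _ _ _ hu) addn1 mulSn
      -addnA [(i * _ + _)%N]addnC.
  apply: le_trans (block_step _ _ _ _ mu0 pw hv hm) _.
  rewrite -mulrA -expRD; apply: ler_wpM2l; first exact: ler0n.
  by rewrite ler_expR mulSn natrD; lra.
- split => //.
    move/mapP: hv => [a ha ->]; rewrite !size_cat hs.
    exact: etrans (addn1 _) (esym (addn0 _)).
  have := digit_step mu 64 1 w 0 (dY st) v mu0 (lexx _) (ltnW Y3) pw hv.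
  rewrite cats0 => /(_ hm); rewrite mulr1 powR1 mul1r mul0n mul0r oppr0 expR0 mulr1.
  move/le_trans; apply.
  have h1 : (dY st)%:R `^ (s - 1) <= 1.
    by rewrite -[leRHS](powRr0 (dY st)%:R); apply: ler_powR => //; lra.
  lra.
- rewrite im ltnn; split => //.
    move/mapP: hv => [a ha ->]; rewrite !size_cat hs size_nseq im [size [:: _]]/= addn1.
    by rewrite addnS stage_len.
  rewrite im in hm.
  have hX := X_mass st mu w mu0 pw hm.
  apply: le_trans (digit_step mu 1 _ w _ _ v mu0 YR (ltnW X3) pw hv hX) _.
  rewrite mulr1 (_ : 64 = 16 * 4) ?ler_wpM2l//; last by ring.
  set tau := (nxt st)%:R * b2.
  have hY : (dY st)%:R `^ s <= 2 * expR (s * (tau * (1 - 2 * al))).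
    apply: (@le_trans _ _ ((2 * expR (tau * (1 - 2 * al))) `^ s)).
      by apply: powR_mono => //; rewrite /tau -mulrA.
    have l1 : 1 <= 2 :> R by rewrite ler1n.
    apply: le_trans (powR_const_le _ _ l1 (expR_ge0 _)) _.
    by rewrite -expRM (mulrC _ s).
  have hX' : (dX st)%:R `^ (s - 1) <= expR ((s - 1) * (tau * al)).
    rewrite powR_expR ?ltr0n// ler_expR ler_wnM2l//; first lra.
    by rewrite -[leLHS]expRK ler_ln ?posrE ?expR_gt0 ?ltr0n// /tau -mulrA.
  apply: (@le_trans _ _ (2 * expR (s * (tau * (1 - 2 * al))) * expR ((s - 1) * (tau * al)))).
    by apply: ler_pM; rewrite ?powR_ge0.
  rewrite -mulrA -expRD.
  have -> : s * (tau * (1 - 2 * al)) + (s - 1) * (tau * al) = tau * (s - al * (1 + s)) by ring.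
  by rewrite alE2 subrr mulr0 expR0 mulr1 ler_nat.
Qed.

Let invariant_all y j : 0 <= y < 1 -> invariant (state j) (tw y j) (tmu y j).
Proof.
move=> y01; elim: j => [|j IH].
  split => //=; rewrite mul0n mul0r oppr0 expR0 mulr1 mul1r /cfq /= expr1n powR1; lra.
rewrite /state iterS -/(state j) /tw tree_wS /tmu tree_muS.
apply: invariant_step => //.
- exact: ltW (tree_mu_gt0 lev wt wt0 wts y j y01).
- exact: (tree_w_pos lev wt wt0 wts lpos y j y01).
- exact: (tree_v_mem lev wt wt0 wts y j y01).
Qed.

Let mass_bound_all y j : 0 <= y < 1 -> mass_bound s 1024 (kd j) (tw y j) (tmu y j).
Proof.
move=> y01; have := invariant_all y j y01.
have mu0 : 0 <= tmu y j := ltW (tree_mu_gt0 lev wt wt0 wts y j y01).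
have pw : pos_word (tw y j) := tree_w_pos lev wt wt0 wts lpos y j y01.
rewrite /kd /kind_of; case: (state j) => st i [/= hi hs].
case: ltngtP => im hm /=.
- apply: le_trans hm _.
  have e1 : expR (- ((i * N.+1)%:R * c)) <= 1.
    by rewrite -[leRHS]expR0 ler_expR oppr_le0; exact: mulr_ge0 (ler0n _ _) (ltW c_gt0).
  lra.
- by rewrite cats0; apply: le_trans hm _; lra.
- by rewrite im in hm; apply: le_trans (X_mass st _ _ mu0 pw hm) _; lra.
Qed.

Let state_addn j d : ((state j).2 + d <= (stage_m (state j).1).+1)%N ->
  state (j + d) = ((state j).1, (state j).2 + d)%N.
Proof.
elim: d => [|d IH] h; first by rewrite !addn0; case: (state j).
rewrite addnS /state iterS -/(state (j + d)) IH; last by apply: leq_trans h; rewrite leq_add2l.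
by rewrite /next /= -ltnS -addnS h addnS.
Qed.

Let state_digit j : exists2 j', (j <= j')%N & (state j').2 = stage_m (state j').1.
Proof.
have aux j0 : ((state j0).2 <= stage_m (state j0).1)%N ->
    exists2 j', (j0 <= j')%N & (state j').2 = stage_m (state j').1.
  move=> h; exists (j0 + (stage_m (state j0).1 - (state j0).2))%N; first exact: leq_addr.
  by rewrite state_addn /= subnKC.
have [/aux//|h] := leqP (state j).2 (stage_m (state j).1).
have [|j' jj' h'] := aux j.+1; last by exists j' => //; exact: ltnW.
by rewrite /state iterS -/(state j) /next (leqNgt (state j).2) h.
Qed.

Lemma hausdorff_dim_E21_ge_sparse (Psi : nat -> R) :
  (forall st, Psi (nxt st) <= expR ((nxt st)%:R * b2)) ->
  (s%:E <= hausdorff_dim (E_set 2 1 Psi))%E.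
Proof.
move=> hPsi; have A0 : 0 < 1024 :> R by lra.
apply: (hausdorff_dim_ge_tree M N s s_gt0 (ltW s_lt1) wsum_ge2 kd kd_ok 1024 _ A0
  mass_bound_all).
move=> y x z y01 hz; split.
  by have [/andP[z0 z1] -> _] := hz 0%N; rewrite /= (ltW z0) z1.
move=> /finite_seqP[l lE].
(* Every level appends a digit, so the position [n] reached after level [k] exceeds every member of
   [l]. *)
pose k := (\max_(n <- l) n).+1.
have [j kj jm] := state_digit k.
pose st := (state j).1; pose n := nxt st.
have stS : state j.+1 = (st, (stage_m st).+1).
  by rewrite /state iterS -/(state j) /next jm leqnn.
have hs2 : size (tw y j.+1) = n.
  by have [_ + _] := invariant_all y j.+1 y01; rewrite stS [X in (if X then _ else _)]ltnn.
have kdj : kd j = Digit (stage_r st) (dX st) by rewrite /kd /kind_of jm ltnn eqxx.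
have kdj1 : kd j.+1 = Digit 0 (dY st).
  by rewrite /kd stS /kind_of /= ltnNge leqnSn /= gtn_eqF.
have := tree_v_mem lev wt wt0 wts y j y01; rewrite {2}/lev kdj => /mapP[a _ va].
have := tree_v_mem lev wt wt0 wts y j.+1 y01; rewrite {2}/lev kdj1 => /mapP[d _ vd].
have [zj xE0 _] := hz j.+2; have xE : x = cf (tw y j.+2) (z j.+2) := xE0.
have pw : pos_word (tw y j.+2) := tree_w_pos lev wt wt0 wts lpos y j.+2 y01.
have wE : tw y j.+2 = tw y j.+1 ++ [:: (dY st + d)%N] by rewrite /tw tree_wS vd.
have wE1 : tw y j.+1 = (tw y j ++ nseq (stage_r st) 2%N) ++ [:: (dX st + a)%N].
  by rewrite /tw tree_wS va catA.
have n0 : (0 < n)%N by apply: leq_ltn_trans (nxt_gt st).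
have s2 : size (tw y j.+2) = n.+1 by rewrite wE size_cat hs2 addn1.
(* Partial quotients are numbered from 1, so $a_n$ is the letter of index [n.-1], the last one of
   [tw y j.+1]. *)
have pqn : partial_quotient n x = (dX st + a)%N.
  rewrite xE -{1}(prednK n0) partial_quotient_cf// ?s2; last by rewrite prednK.
  have h : size (tw y j ++ nseq (stage_r st) 2%N) = n.-1.
    by rewrite -hs2 wE1 (size_cat (tw y j ++ _)) addn1.
  by rewrite wE wE1 -catA nth_cat h ltnn subnn.
have pqn1 : partial_quotient n.+1 x = (dY st + d)%N.
  by rewrite xE partial_quotient_cf ?s2// wE nth_cat hs2 ltnn subnn.
have nl : n \in l.
  have : [set` l] n; last by [].
  rewrite -lE /=; split=> //; rewrite pqn pqn1.
  have [/andP[X1 X2] X3] := dX_bounds st; have [/andP[Y1 Y2] Y3] := dY_bounds st.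
  apply: le_trans (hPsi st) _; rewrite powRr1// powR_mulrn//.
  have -> : expR (n%:R * b2) =
    expR (n%:R * (b2 * al)) ^+ 2 * expR (n%:R * (b2 * (1 - 2 * al))).
    by rewrite -expRM_natl -expRD; congr expR; ring.
  apply: ler_pM; rewrite ?exprn_ge0 ?expR_ge0//.
    by rewrite lerXn2r ?nnegrE ?expR_ge0// (le_trans X1)// ler_nat leq_addr.
  by rewrite (le_trans Y1)// ler_nat leq_addr.
have := @leq_bigmax_seq _ l xpredT id n nl isT.
have := tree_size lev wt wt0 wts lsize y j.+1 y01.
rewrite -/tw hs2 => h1; rewrite leqNgt => /negP; apply.
by apply: leq_trans (leqW kj) _; exact: leq_trans h1.
Qed.

End LowerBound.

(** * From the lower limit of [Psi] to the two dimension bounds *)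

Section DimensionComparison.
Context {R : realType}.
Implicit Types (s b : R) (Psi : nat -> R).

Lemma hausdorff_dim_E21_ge b b' s Psi : 0 < b -> b < b' -> 1 / 2 <= s -> s < 1 ->
  supercritical b' s ->
  (forall b2, b < b2 -> forall n0, exists2 n, (n0 <= n)%N & Psi n <= expR (n%:R * b2)) ->
  (s%:E <= hausdorff_dim (E_set 2 1 Psi))%E.
Proof.
move=> b0 bb' s12 s1 [N [M [N0 hW]]] hPsi.
have s0 : 0 < s by lra.
have f0 := lower_exponent_gt0 _ s0; set f := lower_exponent s in hW f0.
(* Above [b], so that [Psi n] is at most $e^{n b_2}$ for arbitrarily large $n$; below [b'], so that
   the gain of the blocks grows linearly in $n$. *)
pose b2 := (b + b') / 2.
have bb2 : b < b2 by rewrite /b2; lra.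
have d0 : 0 < (b' - b2) * f by rewrite pmulr_lgt0// /b2; lra.
have b'0 : 0 < b' by lra.
have c0 : 0 < b' * f by exact: mulr_gt0.
have /choice[nxt hnxt] : forall st : nat, exists n : nat, [/\ (st < n)%N,
    Psi n <= expR (n%:R * b2) &
    2048 * 16 ^+ N.+1 * expR (- ((b' * f) * (n%:R - 1 - st%:R - N.+1%:R))) *
      expR (n%:R * (b2 * f)) <= 1].
  move=> st; pose K := 2048 * 16 ^+ N.+1 : R.
  pose D := K + b' * f * (1 + st%:R + N.+1%:R).
  have [n hn hP] := hPsi b2 bb2 (maxn st.+1 (Num.truncn (D / ((b' - b2) * f))).+1).
  move: hn; rewrite geq_max => /andP[stn Dn]; exists n; split; [exact: stn|exact: hP|].
  have Dn' : D <= n%:R * ((b' - b2) * f).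
    rewrite -ler_pdivrMr//; apply: le_trans (ltW (truncnS_gt _)) _.
    by rewrite ler_nat.
  have hK : K <= expR K by have := expR_ge1Dx K; lra.
  rewrite -/K -mulrA -expRD.
  apply: le_trans (ler_wpM2r (expR_ge0 _) hK) _.
  rewrite -expRD -[leRHS]expR0 ler_expR; move: Dn'; rewrite /D.
  move: (n%:R) (st%:R) (N.+1%:R) K {hK D Dn} => x y z K.
  lra.
have b20 : 0 < b2 by lra.
apply: (hausdorff_dim_E21_ge_sparse M N s b2 b' nxt s0 s1 b20 b'0 hW).
- by move=> st; have [] := hnxt st.
- by move=> st; have [] := hnxt st.
- by move=> st; have [] := hnxt st.
Qed.

(** The eventual lower bound serves the covering, the upper bound along arbitrarily large [n] the
    Cantor set. *)
Lemma limn_einf_rateP Psi b : (forall n, (1 <= n)%N -> 1 <= Psi n) ->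
  limn_einf (fun n => (ln (Psi n) / n%:R)%:E) = b%:E ->
  (forall b1, b1 < b -> exists n0, forall n, (n0 <= n)%N -> expR (n%:R * b1) <= Psi n) /\
  (forall b2, b < b2 -> forall n0, exists2 n, (n0 <= n)%N & Psi n <= expR (n%:R * b2)).
Proof.
move=> Psi1; set u := fun n => _ => hb.
have {}hb : ereal_sup (range (einfs u)) = b%:E.
  by rewrite -hb limn_einf_lim; apply/esym/cvg_lim => //; exact: cvg_einfs_sup.
have Psi0 n : (0 < n)%N -> 0 < Psi n by move=> /Psi1; exact: lt_le_trans.
split => [b1 b1b|b2 bb2 n0].
- have : (b1%:E < ereal_sup (range (einfs u)))%E by rewrite hb lte_fin.
  move=> /ereal_sup_gt[_ [m _ <-] hm].
  (* The index 0 is left out: there the quotient has the default value 0. *)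
  exists (maxn m 1) => n; rewrite geq_max => /andP[mn n1].
  have : (b1%:E < u n)%E.
    by apply: lt_le_trans hm _; apply: ereal_inf_lbound; exists n.
  rewrite lte_fin ltr_pdivlMr ?ltr0n// => h.
  rewrite -[leRHS]lnK ?posrE ?Psi0// ler_expR mulrC; exact: ltW.
- have : (ereal_inf (sdrop u (maxn n0 1)) < b2%:E)%E.
    apply: le_lt_trans (_ : b%:E < _)%E; last by rewrite lte_fin.
    by rewrite -hb; apply: ereal_sup_ubound; exists (maxn n0 1).
  move=> /ereal_inf_lt[_ [n /= nn <-]]; move: nn; rewrite geq_max => /andP[n0n n1].
  rewrite lte_fin ltr_pdivrMr ?ltr0n// => h; exists n => //.
  by rewrite -[leLHS]lnK ?posrE ?Psi0// ler_expR mulrC ltW.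
Qed.

End DimensionComparison.

Theorem mainTheorem4 (R : realType) :
  (forall s : R, 1 / 2 < s < 1 -> f_exponent 2 1 s < f_exponent 1 2 s) /\
  (forall (Psi : nat -> R) (B : \bar R),
     (forall n, (1 <= n)%N -> 1 <= Psi n) ->
     B = expeR (limn_einf (fun n => (ln (Psi n) / n%:R)%:E)) ->
     (1 < B < +oo)%E ->
     (hausdorff_dim (E_set 1 2 Psi) < hausdorff_dim (E_set 2 1 Psi))%E).
Proof.
split=> [s|Psi B Psi1 -> hB]; first exact: f_exponent21_lt12.
have [b hb b0] : exists2 b, limn_einf (fun n => (ln (Psi n) / n%:R)%:E) = b%:E & 0 < b.
  move: hB; case: (limn_einf _) => [b| |] /=.
  - by rewrite lte_fin -[X in X < _]expR0 ltr_expR => /andP[b0 _]; exists b.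
  - by rewrite ltxx andbF.
  - by rewrite ltNge lee_fin ler01.
have [lo hi] := limn_einf_rateP _ _ Psi1 hb.
have [s [/andP[s12 s1] sub sup]] := exists_intermediate_exponent _ b0.
have [s' [b' [ss' bb' sup']]] := supercritical_open _ _ (ltW s12) sup.
have s'1 : s' < 1 by apply: supercritical_lt1 sup'; lra.
apply: (@le_lt_trans _ _ s%:E); first exact: hausdorff_dim_E12_le sub lo.
apply: (@lt_le_trans _ _ s'%:E); first by rewrite lte_fin.
by apply: hausdorff_dim_E21_ge b0 bb' _ s'1 sup' hi; lra.
Qed.
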